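(* Any $5$-dimensional complex Lie algebra $\mathfrak g$ without $3$-dimensional abelian ideals is isomorphic to one of the following: - (NS1) $\mathfrak{sl}(2,\mathbb{C})\times\mathbb{C}^2$; - (NS2) $\mathfrak{sl}(2,\mathbb{C})\ltimes\mathbb{C}^2$; - (NS3) $\mathfrak{sl}(2,\mathbb{C})\times\mathfrak r_2$, where $\mathfrak r_2$ is a $2$-dimensional non-abelian Lie algebra; - (SOL) the Lie algebra of upper-triangular matrices in $\mathfrak{sl}(3,\mathbb{C})$.
   Context: In (NS1), $\mathbb{C}^2$ is the abelian Lie algebra and the product is direct. In (NS2), $\mathfrak{sl}(2,\mathbb{C})$ acts on the abelian ideal $\mathbb{C}^2$ by its standard representation. *)

(* Defs.v *)
From HB Require Import structures.
From mathcomp Require Import all_boot all_order all_algebra.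
From mathcomp Require Import complex reals.
From mathcomp Require Import ring.

Set Implicit Arguments.
Unset Strict Implicit.
Unset Printing Implicit Defensive.

Import GRing.Theory.
Local Open Scope ring_scope.

Reserved Notation "[lie x , y ]" (at level 0, x, y at level 99,
  format "[lie  x ,  y ]").

(* [lmodType] suffices for the axioms: the concrete algebras below need no
   chosen basis.  Only [finLieAlgType] carries a dimension. *)
HB.mixin Record isLieAlgebra (K : fieldType) L of GRing.Lmodule K L := {
  lie : L -> L -> L;
  lie_linearl : forall y, linear (fun x => lie x y);
  lie_linearr : forall x, linear (lie x);
  liexx : forall x, lie x x = 0;
  lie_jacobi : forall x y z,
    lie x (lie y z) + lie y (lie z x) + lie z (lie x y) = 0
}.

#[short(type="lieAlgType")]
HB.structure Definition LieAlgebra (K : fieldType) :=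
  {L of isLieAlgebra K L & GRing.Lmodule K L}.

#[short(type="finLieAlgType")]
HB.structure Definition FinLieAlgebra (K : fieldType) :=
  {L of isLieAlgebra K L & Vector K L}.

Notation "[lie x , y ]" := (lie x y) : ring_scope.

Definition lie_isog (K : fieldType) (L1 L2 : lieAlgType K) : Prop :=
  exists f : {linear L1 -> L2},
    bijective f /\ forall x y, f [lie x, y] = [lie f x, f y].

Definition lie_abelian (K : fieldType) (L : lieAlgType K) : Prop :=
  forall x y : L, [lie x, y] = 0.

Section Subspaces.
Variables (K : fieldType) (L : finLieAlgType K).

Definition lie_ideal (I : {vspace L}) : Prop :=
  forall x y, y \in I -> [lie x, y] \in I.

Definition lie_abelian_on (I : {vspace L}) : Prop :=
  {in I &, forall x y, [lie x, y] = 0}.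

End Subspaces.

Section Commutator.
Variables (K : fieldType) (n : nat).
Implicit Types A B C : 'M[K]_n.

Definition mxlie A B := A *m B - B *m A.

Fact mxlie_linearl B : linear (mxlie^~ B).
Proof.
move=> a A C; rewrite /mxlie mulmxDl mulmxDr -scalemxAl -scalemxAr.
by rewrite scalerBr opprD addrACA.
Qed.

Fact mxliexx A : mxlie A A = 0.
Proof. exact: subrr. Qed.

Fact mxlieC A B : mxlie A B = - mxlie B A.
Proof. by rewrite /mxlie opprB. Qed.

Fact mxlie_linearr A : linear (mxlie A).
Proof.
by move=> a B C; rewrite !(mxlieC A) mxlie_linearl opprD scalerN.
Qed.

Fact mxlie_jacobi A B C :
  mxlie A (mxlie B C) + mxlie B (mxlie C A) + mxlie C (mxlie A B) = 0.
Proof.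
rewrite /mxlie !mulmxBl !mulmxBr !mulmxA !opprB.
set a := A *m B *m C; set b := A *m C *m B; set c := B *m C *m A.
set d := C *m B *m A; set e := B *m A *m C; set f := C *m A *m B.
by apply/matrixP=> i j; rewrite !mxE; ring.
Qed.

HB.instance Definition _ :=
  isLieAlgebra.Build K 'M[K]_n mxlie_linearl mxlie_linearr mxliexx mxlie_jacobi.

End Commutator.

Section Subalgebra.
Variables (K : fieldType) (L : lieAlgType K).

Definition lie_closed (S : {pred L}) : Prop :=
  {in S &, forall x y, [lie x, y] \in S}.

Record lieSubalg := LieSubalg {
  lieSubalg_pred :> {pred L};
  lieSubalg_submod : submod_closed lieSubalg_pred;
  lieSubalg_lie : lie_closed lieSubalg_pred
}.

Variable S : lieSubalg.

HB.instance Definition _ :=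
  GRing.isSubmodClosed.Build K L (lieSubalg_pred S) (lieSubalg_submod S).

Record lieSub := LieSub {
  lieSub_val :> L;
  lieSub_valP : lieSub_val \in lieSubalg_pred S
}.

HB.instance Definition _ := [isSub for lieSub_val].
HB.instance Definition _ := [Choice of lieSub by <:].
HB.instance Definition _ := [SubChoice_isSubLmodule of lieSub by <:].

Implicit Types x y z : lieSub.

Definition lieSub_lie x y : lieSub :=
  LieSub (lieSubalg_lie (lieSub_valP x) (lieSub_valP y)).

Fact lieSub_linearl y : linear (lieSub_lie^~ y).
Proof. by move=> a x z; apply: val_inj; rewrite /= lie_linearl. Qed.

Fact lieSub_linearr x : linear (lieSub_lie x).
Proof. by move=> a y z; apply: val_inj; rewrite /= lie_linearr. Qed.

Fact lieSub_liexx x : lieSub_lie x x = 0.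
Proof. by apply: val_inj; rewrite /= liexx. Qed.

Fact lieSub_jacobi x y z :
  lieSub_lie x (lieSub_lie y z) + lieSub_lie y (lieSub_lie z x)
    + lieSub_lie z (lieSub_lie x y) = 0.
Proof. by apply: val_inj; rewrite /= lie_jacobi. Qed.

HB.instance Definition _ := isLieAlgebra.Build K lieSub
  lieSub_linearl lieSub_linearr lieSub_liexx lieSub_jacobi.

End Subalgebra.

Section SpecialLinear.
Variables (K : fieldType) (n : nat).

Definition traceless : {pred 'M[K]_n} := [pred A | \tr A == 0].

Fact traceless_submod : submod_closed traceless.
Proof.
split=> [|a A B]; rewrite !inE ?linear0 // => /eqP trA /eqP trB.
by rewrite linearP /= trA trB mulr0 addr0.
Qed.

Fact traceless_lie : lie_closed traceless.
Proof. by move=> A B _ _; rewrite inE linearB /= mxtrace_mulC subrr. Qed.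

Definition sl : lieAlgType K :=
  lieSub (LieSubalg traceless_submod traceless_lie).

(* [is_trig_mx] is lower triangularity, hence the transpose. *)
Definition upper_trig : {pred sl} := [pred A : sl | is_trig_mx (val A)^T].

Fact upper_trigP (A : sl) :
  reflect (forall i j : 'I_n, (j < i)%N -> val A i j = 0) (A \in upper_trig).
Proof.
apply: (iffP is_trig_mxP) => trA i j lt_ij.
  by have := trA _ _ lt_ij; rewrite mxE.
by rewrite mxE trA.
Qed.

Fact upper_trig_submod : submod_closed upper_trig.
Proof.
split=> [|a A B /upper_trigP trA /upper_trigP trB].
  by apply/upper_trigP=> i j _; rewrite linear0 mxE.
apply/upper_trigP=> i j lt_ji.
by rewrite linearP !mxE trA ?trB // mulr0 addr0.
Qed.

Fact upper_trig_lie : lie_closed upper_trig.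
Proof.
move=> A B /upper_trigP trA /upper_trigP trB; apply/upper_trigP=> i j lt_ji.
have tr0 (C D : 'M[K]_n) :
    (forall i j : 'I_n, (j < i)%N -> C i j = 0) ->
    (forall i j : 'I_n, (j < i)%N -> D i j = 0) -> (C *m D) i j = 0.
  move=> trC trD; rewrite mxE big1 // => k _.
  have [lt_ki|le_ik] := ltnP k i; first by rewrite trC ?mul0r.
  by rewrite trD ?mulr0 // (leq_trans lt_ji).
by rewrite /= [LHS]mxE [X in _ + X]mxE !tr0 // subr0.
Qed.

Definition upper_sl : lieAlgType K :=
  lieSub (LieSubalg upper_trig_submod upper_trig_lie).

End SpecialLinear.

Section Abelian.
Variables (K : fieldType) (V : lmodType K).

(* An alias, so that the zero bracket is not inferred on [V] itself. *)
Definition abelian_lie : Type := V.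

HB.instance Definition _ := GRing.Lmodule.on abelian_lie.

Definition zero_lie (x y : abelian_lie) : abelian_lie := 0.

Fact zero_linearl y : linear (zero_lie^~ y).
Proof. by move=> a x z; rewrite scaler0 addr0. Qed.

Fact zero_linearr x : linear (zero_lie x).
Proof. by move=> a y z; rewrite scaler0 addr0. Qed.

Fact zero_liexx x : zero_lie x x = 0.
Proof. by []. Qed.

Fact zero_jacobi x y z :
  zero_lie x (zero_lie y z) + zero_lie y (zero_lie z x)
    + zero_lie z (zero_lie x y) = 0.
Proof. by rewrite !addr0. Qed.

HB.instance Definition _ := isLieAlgebra.Build K abelian_lie
  zero_linearl zero_linearr zero_liexx zero_jacobi.

End Abelian.

Section DirectProduct.
Variables (K : fieldType) (L1 L2 : lieAlgType K).
Implicit Types x y z : (L1 * L2)%type.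

Definition prod_lie x y : L1 * L2 := ([lie x.1, y.1], [lie x.2, y.2]).

Fact prod_linearl y : linear (prod_lie^~ y).
Proof. by move=> a x z; rewrite /prod_lie /= !lie_linearl. Qed.

Fact prod_linearr x : linear (prod_lie x).
Proof. by move=> a y z; rewrite /prod_lie /= !lie_linearr. Qed.

Fact prod_liexx x : prod_lie x x = 0.
Proof. by rewrite /prod_lie !liexx. Qed.

Fact prod_jacobi x y z :
  prod_lie x (prod_lie y z) + prod_lie y (prod_lie z x)
    + prod_lie z (prod_lie x y) = 0.
Proof. by congr pair; apply: lie_jacobi. Qed.

HB.instance Definition _ := isLieAlgebra.Build K (L1 * L2)%type
  prod_linearl prod_linearr prod_liexx prod_jacobi.

End DirectProduct.

Record lieRep (K : fieldType) (L : lieAlgType K) (V : lmodType K) := LieRep {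
  rep_act :> L -> V -> V;
  rep_linearl : forall v, linear (fun x => rep_act x v);
  rep_linearr : forall x, linear (rep_act x);
  rep_lie : forall x y v,
    rep_act [lie x, y] v = rep_act x (rep_act y v) - rep_act y (rep_act x v)
}.

Section SemidirectProduct.
Variables (K : fieldType) (L : lieAlgType K) (V : lmodType K).

(* The argument is unused in the carrier: it lets the bracket instance below
   recover the action. *)
Definition semidirect (_ : lieRep L V) : Type := (L * V)%type.

Variable rho : lieRep L V.

HB.instance Definition _ := GRing.Lmodule.on (semidirect rho).

Implicit Types x y z : semidirect rho.

Definition semidirect_lie x y : semidirect rho :=
  ([lie x.1, y.1], rho x.1 y.2 - rho y.1 x.2).

Fact semidirect_linearl y : linear (semidirect_lie^~ y).
Proof.
move=> a x z; congr pair; rewrite /= ?lie_linearl //.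
by rewrite rep_linearl rep_linearr opprD addrACA scalerBr.
Qed.

Fact semidirect_linearr x : linear (semidirect_lie x).
Proof.
move=> a y z; congr pair; rewrite /= ?lie_linearr //.
by rewrite rep_linearl rep_linearr opprD addrACA scalerBr.
Qed.

Fact semidirect_liexx x : semidirect_lie x x = 0.
Proof. by rewrite /semidirect_lie liexx subrr. Qed.

Fact semidirect_jacobi x y z :
  semidirect_lie x (semidirect_lie y z) + semidirect_lie y (semidirect_lie z x)
    + semidirect_lie z (semidirect_lie x y) = 0.
Proof.
have rhoB u (v w : V) : rho u (v - w) = rho u v - rho u w.
  by rewrite -scaleN1r addrC rep_linearr scaleN1r addrC.
congr pair; first exact: lie_jacobi.
rewrite /= !rhoB !rep_lie.
set a := rho _ (rho _ z.2); set b := rho _ (rho _ y.2).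
set c := rho _ (rho _ x.2); set d := rho _ (rho _ x.2).
set e := rho _ (rho _ z.2); set f := rho _ (rho _ y.2).
rewrite !opprB !addrA.
rewrite [LHS](AC 12 ((1*12)*(7*2)*(3*10)*(5*4)*(11*6)*(9*8))) /=.
by rewrite !subrr !addr0.
Qed.

HB.instance Definition _ := isLieAlgebra.Build K (semidirect rho)
  semidirect_linearl semidirect_linearr semidirect_liexx semidirect_jacobi.

End SemidirectProduct.

Section StandardRepresentation.
Variables (K : fieldType) (n : nat).

Definition sl_std_act (A : sl K n) (v : 'cV[K]_n) : 'cV[K]_n := val A *m v.

Fact sl_std_linearl v : linear (sl_std_act^~ v).
Proof. by move=> a A B; rewrite /sl_std_act linearP mulmxDl scalemxAl. Qed.

Fact sl_std_linearr A : linear (sl_std_act A).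
Proof. by move=> a v w; rewrite /sl_std_act linearP. Qed.

Fact sl_std_lie A B v :
  sl_std_act [lie A, B] v
    = sl_std_act A (sl_std_act B v) - sl_std_act B (sl_std_act A v).
Proof. by rewrite /sl_std_act mulmxBl !mulmxA. Qed.

Definition sl_std : lieRep (sl K n) 'cV[K]_n :=
  LieRep sl_std_linearl sl_std_linearr sl_std_lie.

End StandardRepresentation.

(* Main.v *)
From HB Require Import structures.
Require Import Defs.
From mathcomp Require Import all_boot all_order all_algebra.
From mathcomp Require Import complex reals boolp classical_sets.
From mathcomp Require Import ring zify.

(* Non-solvable case: applied to a maximal solvable subalgebra of the derived algebra,
   Lie's theorem yields x in [g, g] with ad x not nilpotent. The trace of ad z on a
   generalized eigenspace of ad x is nonzero at z = x, which forces two root vectors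
   e, f of opposite weights a, - a with [e, f] <> 0. Since tr (ad x) = 0 in dimension
   5, the weights are 0, a, - a, m, - m. If m = 0, then e, f, [e, f] span a copy of
   sl(2), which is a direct factor with its centralizer as complement; the Jacobi
   identity excludes m = a and m = - a; otherwise it forces a = 2 m up to the sign
   of m, and g is the semidirect product.
   Solvable case: a maximal abelian ideal A is its own centralizer and has dimension
   at most 2, by Lie's theorem; hence dim A = 2, g / A is the full algebra of
   triangular endomorphisms of A, and the extension splits. *)

Set Implicit Arguments.
Unset Strict Implicit.
Unset Printing Implicit Defensive.

Import Order.TTheory GRing.Theory Num.Theory VectorInternalTheory.
Local Open Scope ring_scope.

(** No Levi decomposition or Killing form is used: the single element [x] stands in for a Cartan
    subalgebra. Taking it in the derived algebra is what makes the weights of [ad x] sum to zero.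
    Since [x] need not act semisimply, weights are read on generalized eigenspaces; true
    eigenvectors come back once these are lines. On the space of weight [a] the trace of [ad x] is
    [a] times the dimension, nonzero in characteristic 0 although the total trace vanishes: this
    local trace replaces an invariant form. Quotients are never formed: a statement about [V / W] is
    one about elements of [V] up to membership in [W]. In the solvable case the bound on [A] comes
    from Lie's theorem because it puts, inside any ideal, subideals of every smaller dimension. *)

Section LieBasics.
Variables (K : fieldType) (L : lieAlgType K).
Implicit Types (x y z : L) (a : K).

HB.instance Definition _ x :=
  GRing.isLinear.Build K L L *:%R (lie x) (lie_linearr x).

Lemma lieDl x y z : [lie x + y, z] = [lie x, z] + [lie y, z].
Proof. by have := lie_linearl z 1 x y; rewrite /= !scale1r. Qed.

Lemma lie0l z : [lie 0, z] = 0 :> L.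
Proof. by apply: (addrI [lie 0, z]); rewrite -lieDl !addr0. Qed.

Lemma lieZl a x z : [lie a *: x, z] = a *: [lie x, z].
Proof. by have := lie_linearl z a x 0; rewrite /= addr0 lie0l addr0. Qed.

Lemma lieNl x z : [lie - x, z] = - [lie x, z].
Proof. by rewrite -scaleN1r lieZl scaleN1r. Qed.

Lemma lieDr x y z : [lie z, x + y] = [lie z, x] + [lie z, y].
Proof. exact: linearD. Qed.

Lemma lie0r z : [lie z, 0] = 0 :> L. Proof. exact: linear0. Qed.

Lemma lieZr a x z : [lie z, a *: x] = a *: [lie z, x].
Proof. exact: linearZ. Qed.

Lemma lieNr x z : [lie z, - x] = - [lie z, x]. Proof. exact: linearN. Qed.

Lemma lieC x y : [lie x, y] = - [lie y, x].
Proof.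
apply/eqP; rewrite -addr_eq0; apply/eqP.
by have := liexx (x + y); rewrite lieDl !lieDr !liexx add0r addr0.
Qed.

Lemma lie_der x y z : [lie x, [lie y, z]] = [lie [lie x, y], z] + [lie y, [lie x, z]].
Proof.
have /eqP := lie_jacobi x y z; rewrite -addrA addr_eq0 => /eqP ->.
by rewrite opprD addrC (lieC z) opprK (lieC z x) lieNr opprK.
Qed.

Lemma lie_lieE x y z : [lie [lie x, y], z] = [lie x, [lie y, z]] - [lie y, [lie x, z]].
Proof. by rewrite lie_der addrK. Qed.

End LieBasics.

(** * Traces of endomorphisms and of their restrictions to subspaces *)

Section Trace.
Variables (K : fieldType) (V : vectType K).
Implicit Types (f h P Q : 'End(V)) (U W : {vspace V}).

Lemma v2r_lfun f v : v2r (f v) = v2r v *m f2mx f.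
Proof. by rewrite [in LHS]unlock /= r2vK. Qed.

Lemma f2mxP f (A : 'M_(dim V)) :
  (forall v, v2r (f v) = v2r v *m A) -> f2mx f = A.
Proof.
move=> fA; apply/row_matrixP=> i; rewrite !rowE.
by rewrite -(r2vK (delta_mx 0 i)) -fA v2r_lfun.
Qed.

Definition lftrace f : K := \tr (f2mx f).

Fact lftrace_linear : scalar lftrace.
Proof.
move=> a f h; rewrite /lftrace.
have -> : f2mx (a *: f + h) = a *: f2mx f + f2mx h.
  apply: f2mxP => v; rewrite add_lfunE scale_lfunE linearP /= !v2r_lfun.
  by rewrite mulmxDr scalemxAr.
by rewrite linearP.
Qed.
HB.instance Definition _ := GRing.isLinear.Build K _ _ _ lftrace lftrace_linear.

Lemma lftraceC f h : lftrace (f \o h)%VF = lftrace (h \o f)%VF.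
Proof.
have f2mxM f1 f2 : f2mx (f1 \o f2)%VF = f2mx f2 *m f2mx f1.
  by apply: f2mxP => v; rewrite comp_lfunE !v2r_lfun mulmxA.
by rewrite /lftrace !f2mxM mxtrace_mulC.
Qed.

(** In a rank factorization M = B C, idempotence cancels to C B = 1, so tr M = tr (C B) is the
    rank. *)
Lemma lftrace_idem P : (P \o P)%VF = P -> lftrace P = (\dim (limg P))%:R.
Proof.
move=> idP; set M := f2mx P.
have MM : M *m M = M.
  by apply/esym/f2mxP => v; rewrite -{1}idP comp_lfunE !v2r_lfun mulmxA.
have -> : \dim (limg P) = \rank M.
  rewrite unlock /dimv /lfun_img_def.
  by rewrite (mx2vsK _) (eqmxMr _ (mx2vsK _)) mul1mx.
rewrite /lftrace -/M; have := mulmx_base M.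
move: (\rank M) (col_base M) (row_base M) (col_base_full M) (row_base_free M).
move=> r B C /row_fullP[B' B'B] /row_freeP[C' CC'] defM.
move: MM; rewrite -defM => BCBC.
suff CB : C *m B = 1%:M by rewrite mxtrace_mulC CB mxtrace1.
have := congr1 (fun A => B' *m A *m C') BCBC.
by rewrite /= !mulmxA B'B !mul1mx -!mulmxA CC' !mulmx1.
Qed.

(** The hypotheses say that [P] fixes the images of f P and h P. Hence f h P = (f P)(h P), and the
    map is the commutator of f P and h P. *)
Lemma lftrace_comm P f h :
    (f \o P)%VF = (P \o (f \o P))%VF -> (h \o P)%VF = (P \o (h \o P))%VF ->
  lftrace (((f \o h) - (h \o f)) \o P)%VF = 0.
Proof.
move=> fP hP; rewrite comp_lfunDl comp_lfunNl linearB /=.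
apply/eqP; rewrite subr_eq0 -!comp_lfunA fP hP; apply/eqP.
by rewrite comp_lfunA lftraceC -!comp_lfunA.
Qed.

(** The trace of a restriction, kept in the endomorphisms of [V] by composing with a projection onto
    [U]; it has this meaning when [U] is [f]-stable. *)
Definition lftrace_on U f : K := lftrace (f \o projv U)%VF.

Fact lftrace_on_linear U : scalar (lftrace_on U).
Proof.
move=> a f h; rewrite /lftrace_on comp_lfunDl -comp_lfunZl linearP //.
Qed.
HB.instance Definition _ U :=
  GRing.isLinear.Build K _ _ _ (lftrace_on U) (lftrace_on_linear U).

Lemma lftrace_on1 U : lftrace_on U \1%VF = (\dim U)%:R.
Proof.
rewrite /lftrace_on comp_lfun1l lftrace_idem ?limg_proj //.
by apply/lfunP=> v; rewrite comp_lfunE projv_proj.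
Qed.

Lemma comp_projv U f W : (f @: U <= W)%VS ->
  (projv W \o (f \o projv U))%VF = (f \o projv U)%VF.
Proof.
move=> fUW; apply/lfunP=> v; rewrite !comp_lfunE projv_id //.
by apply: (subvP fUW); rewrite memv_img ?memv_proj.
Qed.

Lemma lftrace_on_comm U f h : (f @: U <= U)%VS -> (h @: U <= U)%VS ->
  lftrace_on U ((f \o h) - (h \o f))%VF = 0.
Proof. by move=> fU hU; apply: lftrace_comm; rewrite comp_projv. Qed.

(** Such an [f] induces zero on U / W, so only [W] contributes to the trace. *)
Lemma lftrace_on_sub U W f : (f @: U <= W)%VS -> (W <= U)%VS ->
  lftrace_on U f = lftrace_on W f.
Proof.
move=> fUW WU; rewrite /lftrace_on -(comp_projv fUW) (lftraceC (projv W)) -comp_lfunA.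
congr (lftrace (_ \o _)%VF); apply/lfunP=> v; rewrite comp_lfunE projv_id //.
exact: subvP WU _ (memv_proj _ _).
Qed.

End Trace.

Section Ad.
Variables (K : fieldType) (g : finLieAlgType K).
Implicit Types x y z : g.

Definition ad x : 'End(g) := linfun (lie x).

Lemma adE x y : ad x y = [lie x, y]. Proof. exact: lfunE. Qed.

Lemma ad_lie x y : ad [lie x, y] = ((ad x \o ad y) - (ad y \o ad x))%VF.
Proof.
apply/lfunP=> z; rewrite add_lfunE opp_lfunE !comp_lfunE !adE.
exact: lie_lieE.
Qed.

Fact ad_linear : linear ad.
Proof.
move=> a x y; apply/lfunP=> z; rewrite add_lfunE scale_lfunE !adE.
by rewrite lieDl lieZl.
Qed.
HB.instance Definition _ := GRing.isLinear.Build K _ _ _ ad ad_linear.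

End Ad.

(** Otherwise the dimension would grow at each of the first [\dim {:V}] + 1 steps. The bound on [n]
    is what later fixes the exponent of generalized eigenspaces. *)
Lemma chain_stationary (K : fieldType) (V : vectType K) (U : nat -> {vspace V}) :
  (forall i, (U i <= U i.+1)%VS) ->
  exists2 n, (n <= \dim {:V})%N & U n.+1 = U n.
Proof.
move=> sU; apply: contrapT => nst.
suff /(_ (\dim {:V}).+1 (leqnn _)) : forall i, (i <= (\dim {:V}).+1 -> i <= \dim (U i))%N.
  by rewrite leqNgt ltnS dimvS ?subvf.
elim=> // i IHi lti; apply: leq_ltn_trans (IHi (ltnW lti)) _.
rewrite (ltn_leqif (dimv_leqif_eq (sU i))).
by apply/eqP => eqU; apply: nst; exists i.
Qed.

Section Eigenvectors.
Variables (K : closedFieldType) (V : vectType K).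
Implicit Types (f : 'End(V)) (u v : V) (r : seq K).

Definition eigen_step f u a : V := f u - a *: u.

(** Cayley-Hamilton for the split characteristic polynomial, stated as a fold so that its linear
    factors can be peeled off one at a time. *)
Lemma eigen_annihilator f : exists r, forall u, foldl (eigen_step f) u r = 0.
Proof.
have mx_annihilator n (A : 'M[K]_n) : exists r : seq K,
    forall u : 'rV_n, foldl (fun w b => w *m A - b *: w) u r = 0.
  case: n => [|n] in A *; first by exists [::] => u; rewrite [u]thinmx0.
  have [r def_r] := closed_field_poly_normal (char_poly A).
  move: def_r; rewrite (monicP (char_poly_monic A)) scale1r => def_r.
  exists r => u; have := Cayley_Hamilton A; rewrite {}def_r => CH.
  have {CH}: u *m horner_mx A (\prod_(a <- r) ('X - a%:P)) = 0.
    by rewrite CH mulmx0.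
  elim: r u => [|a r IHr] u; first by rewrite big_nil rmorph1 mulmx1.
  rewrite big_cons rmorphM /= mulmxA rmorphB /= horner_mx_X horner_mx_C.
  by rewrite mulmxBr mul_mx_scalar => /IHr.
have [r rP] := mx_annihilator _ (f2mx f); exists r => u.
apply: v2r_inj; rewrite linear0 -(rP (v2r u)).
elim: r u {rP} => //= a r IHr u; rewrite IHr; congr foldl.
by rewrite /eigen_step linearB linearZ /= v2r_lfun.
Qed.

(* Strip the factors of a split annihilating polynomial one at a time: the last
   vector that is still outside [W] is an eigenvector modulo [W]. *)
Lemma eigenvector_mod f (S W : V -> Prop) u :
    W 0 -> (forall v a, S v -> S (f v - a *: v)) -> S u -> ~ W u ->
  exists v a, [/\ S v, ~ W v & W (f v - a *: v)].
Proof.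
move=> W0 Sf; have [r /(_ u)] := eigen_annihilator f.
elim: r u => [|a r IHr] u /= ru0 Su notWu; first by rewrite ru0 in notWu.
have [Wfu|notWfu] := pselect (W (f u - a *: u)); first by exists u, a.
exact: IHr ru0 (Sf _ _ Su) notWfu.
Qed.

End Eigenvectors.

(** * Lie's theorem *)

Section LieTheorem.
Variables (K : numClosedFieldType) (g : finLieAlgType K).
Implicit Types (x y z v : g) (H U V W : {vspace g}).

(* Solvability as a chain of subalgebras, each an ideal of codimension at most one in
   the next: Lie's theorem is then an induction on the chain. *)
Inductive lie_solvable : {vspace g} -> Prop :=
| LieSolvable0 : lie_solvable 0
| LieSolvableD H y : lie_solvable H -> (forall k, k \in H -> [lie y, k] \in H) ->
    lie_solvable (H + <[y]>).

Definition lie_stable H U := forall h u, h \in H -> u \in U -> [lie h, u] \in U.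

Lemma lie_stableS H H' U : (H <= H')%VS -> lie_stable H' U -> lie_stable H U.
Proof. by move=> /subvP sHH' sU h u /sHH' H'h; apply: sU. Qed.

Lemma lie_stable_ad H U h : lie_stable H U -> h \in H -> (ad h @: U <= U)%VS.
Proof.
move=> sU Hh; apply/subvP => _ /memv_imgP[u Uu ->]; rewrite adE; exact: sU.
Qed.

Lemma lie_stableD H y U : lie_stable H U -> (forall u, u \in U -> [lie y, u] \in U) ->
  lie_stable (H + <[y]>) U.
Proof.
move=> sHU syU _ u /memv_addP[h Hh [_ /vlineP[a ->] ->]] Uu.
by rewrite lieDl lieZl memvD ?memvZ ?syU ?sHU.
Qed.

Lemma lie_solvable_subalg H : lie_solvable H -> lie_stable H H.
Proof.
elim=> [|{}H y _ sHH sy]; first by move=> x y; rewrite memv0 => /eqP->; rewrite lie0l mem0v.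
have sH_ : lie_stable H (H + <[y]>).
  move=> h u Hh /memv_addP[k Hk [_ /vlineP[a ->] ->]].
  rewrite lieDr lieZr memvD ?memvZ //; first by apply/(subvP (addvSl _ _))/sHH.
  by apply/(subvP (addvSl _ _)); rewrite lieC memvN sy.
apply: lie_stableD => // u /memv_addP[k Hk [_ /vlineP[a ->] ->]].
rewrite lieDr lieZr liexx scaler0 addr0.
by apply/(subvP (addvSl _ _))/sy.
Qed.

(** * Stability modulo [W] of the weight spaces of [H] under [ad y], where [y] normalizes [H] *)

Section Weight.
Variables (H W : {vspace g}) (y : g) (lam : g -> K).
Hypotheses (Hy : forall k, k \in H -> [lie y, k] \in H).
Hypotheses (HW : lie_stable H W) (yW : forall w, w \in W -> [lie y, w] \in W).

Let weight v := forall h, h \in H -> [lie h, v] - lam h *: v \in W.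

Variable v : g.
Hypotheses (v_wt : weight v) (notWv : v \notin W).

(** Starting at [W] and stopping before the iterate of index [n] lets [orbit_weight] land in the
    term of the same index: this is the triangularity of the action of [H]. *)
Fixpoint orbit_span n : {vspace g} :=
  if n is n'.+1 then (orbit_span n' + <[iter n' (lie y) v]>)%VS else W.

Let vn n := iter n (lie y) v.
Let U := orbit_span.

Lemma orbit_spanS n : (U n <= U n.+1)%VS. Proof. exact: addvSl. Qed.

Lemma orbit_spanW n : (W <= U n)%VS.
Proof. by elim: n => // n /subv_trans; apply; apply: orbit_spanS. Qed.

Lemma orbit_mem n : vn n \in U n.+1.
Proof. exact/(subvP (addvSr _ _))/memv_line. Qed.

Lemma orbit_span_y n u : u \in U n -> [lie y, u] \in U n.+1.
Proof.
elim: n u => [|n IHn] u Uu.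
  by apply/(subvP (orbit_spanS 0))/yW.
case/memv_addP: Uu => u' /IHn Uu' [_ /vlineP[a ->] ->].
rewrite lieDr lieZr memvD ?memvZ //; last exact: orbit_mem n.+1.
exact/(subvP (orbit_spanS _)).
Qed.

(** Moving [h] past one more [ad y] creates the extra term [[lie [lie h, y], vn n]]; as [[lie h, y]]
    is again in [H], induction keeps that term in the span already built. *)
Lemma orbit_weight n h : h \in H -> [lie h, vn n] - lam h *: vn n \in U n.
Proof.
elim: n h => [|n IHn] h Hh; first exact: v_wt.
rewrite /vn iterS -/(vn n) lie_der.
have -> : [lie [lie h, y], vn n] + [lie y, [lie h, vn n]] - lam h *: [lie y, vn n] =
    [lie [lie h, y], vn n] + [lie y, [lie h, vn n] - lam h *: vn n].
  by rewrite lieDr lieNr lieZr addrA.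
have Hhy : [lie h, y] \in H by rewrite lieC memvN Hy.
apply: memvD; last exact: orbit_span_y (IHn _ Hh).
rewrite -[[lie _, vn n]](subrK (lam [lie h, y] *: vn n)) memvD ?memvZ ?orbit_mem //.
exact/(subvP (orbit_spanS _))/IHn.
Qed.

Lemma orbit_stable n : lie_stable H (U n).
Proof.
elim: n => // n IHn h _ Hh /memv_addP[u Uu [_ /vlineP[a ->] ->]].
rewrite lieDr lieZr memvD ?memvZ //; first exact/(subvP (orbit_spanS _))/IHn.
rewrite -[[lie _, _]](subrK (lam h *: vn n)) memvD ?memvZ ?orbit_mem //.
exact/(subvP (orbit_spanS _))/orbit_weight.
Qed.

(* On [U n / W], where [U n] is [ad y]-stable, [h, y] is a commutator, hence
   traceless, but acts triangularly with [lam [h, y]] on the diagonal. *)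
Lemma weight_commutator h : h \in H -> lam [lie h, y] = 0.
Proof.
move=> Hh; have [n _ Un] := chain_stationary orbit_spanS.
have Hhy : [lie h, y] \in H by rewrite lieC memvN Hy.
set z := [lie h, y] in Hhy *; set N := ad z - lam z *: \1%VF.
have trN i : lftrace_on (U i) N = lftrace_on W N.
  elim: i => // i <-; apply: lftrace_on_sub (orbit_spanS _).
  apply/subvP => _ /memv_imgP[_ /memv_addP[u Uu [_ /vlineP[a ->] ->]] ->].
  rewrite linearD linearZ /= !add_lfunE !opp_lfunE !scale_lfunE !id_lfunE !adE.
  by rewrite memvD ?memvZ ?orbit_weight ?memvB ?memvZ ?orbit_stable.
have trz X : lie_stable H X -> (ad y @: X <= X)%VS ->
    lftrace_on X N = - (lam z * (\dim X)%:R).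
  move=> sHX yX; rewrite /N linearB linearZ /= lftrace_on1 /z ad_lie.
  by rewrite lftrace_on_comm ?sub0r // (lie_stable_ad sHX).
(* The commutator contributes nothing on [U n] or on [W], so lam z times the difference of the two
   dimensions is zero. In characteristic 0 this leaves equal dimensions, excluded because [v] is in
   [U n] but not in [W]. *)
have := trN n; rewrite !trz ?HW //.
- move=> /oppr_inj/eqP; rewrite -subr_eq0 -mulrBr mulf_eq0 => /orP[/eqP->//|].
  rewrite subr_eq0 eqr_nat => /eqP dimU.
  have /eqP eqWU : W == U n by rewrite eqEdim orbit_spanW dimU /=.
  have : v \in U n.
    rewrite -Un; elim: (n) => [|m IHm]; first exact: orbit_mem 0.
    exact/(subvP (orbit_spanS _)).
  by rewrite -eqWU (negPf notWv).
- by apply/subvP => _ /memv_imgP[u Wu ->]; rewrite adE yW.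
- exact: orbit_stable.
- by apply/subvP => _ /memv_imgP[u Uu ->]; rewrite adE -Un orbit_span_y.
Qed.

(** The obstruction to keeping the weight is lam of [[lie h, y]], which has just been shown to
    vanish. *)
Lemma weight_lie : weight [lie y, v].
Proof.
move=> h Hh; have := weight_commutator Hh => lam0.
rewrite lie_der -addrA memvD //.
  have Hhy : [lie h, y] \in H by rewrite lieC memvN Hy.
  by have := v_wt Hhy; rewrite lam0 scale0r subr0.
by rewrite -lieZr -lieNr -lieDr yW ?v_wt.
Qed.

End Weight.

(** A common eigenvector of [H] in the nonzero quotient V / W. Keeping [W] arbitrary allows both the
    passage to a normalizer and the step-by-step growth of ideals. *)
Theorem lie_eigenvector H V W : lie_solvable H -> lie_stable H V -> lie_stable H W ->
    (W <= V)%VS -> ~~ (V <= W)%VS ->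
  exists2 v, v \in V /\ v \notin W &
    exists lam, forall h, h \in H -> [lie h, v] - lam h *: v \in W.
Proof.
move=> solH; elim: solH V W => [|{}H y solH IH Hy] V W sV sW WV.
  case/subvPn => v Vv notWv; exists v => //; exists (fun=> 0) => h.
  by rewrite memv0 => /eqP ->; rewrite lie0l scale0r subr0 mem0v.
move=> notVW; have sHHy := addvSl H <[y]>; have sHH := lie_solvable_subalg solH.
have [v0 [Vv0 notWv0] [lam v0P]] := IH _ _ (lie_stableS sHHy sV) (lie_stableS sHHy sW) WV notVW.
(* The preimage of the whole [lam]-weight space, [W] included. Once it is stable under [ad y], an
   eigenvector of [y] modulo [W] found in it is common to [H] and [y]. *)
pose S v := v \in V /\ forall h, h \in H -> [lie h, v] - lam h *: v \in W.
have Hyy : y \in (H + <[y]>)%VS by apply/(subvP (addvSr _ _))/memv_line.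
have Sy v a : S v -> S (ad y v - a *: v).
  case=> Vv vP; split; first by rewrite memvB ?memvZ // adE sV.
  (* [weight_lie] needs [v] outside [W]; inside [W] every term is trivially in [W]. *)
  have [Wv|notWv] := boolP (v \in W).
    move=> h Hh; have Hh' := subvP sHHy _ Hh.
    by rewrite adE memvB ?memvZ ?sW ?memvB ?memvZ ?sW.
  move=> h Hh; rewrite adE lieDr lieNr lieZr scalerBr.
  have -> : [lie h, [lie y, v]] - a *: [lie h, v] -
      (lam h *: [lie y, v] - lam h *: (a *: v)) =
      ([lie h, [lie y, v]] - lam h *: [lie y, v]) - a *: ([lie h, v] - lam h *: v).
    rewrite scalerBr opprB opprB !scalerA [lam h * a]mulrC.
    by rewrite addrACA [RHS]addrACA; congr (_ + _); rewrite addrC.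
  rewrite memvB ?memvZ ?vP //.
  apply: (@weight_lie H W y lam) => //.
  - exact: lie_stableS sHHy sW.
  - by move=> w; apply: sW.
have [v [a [[Vv vP] /negP notWv Wv]]] :=
  @eigenvector_mod _ _ (ad y) S (fun v => v \in W) v0 (mem0v W) Sy (conj Vv0 v0P) (negP notWv0).
exists v => //.
(* As [y] may lie in [H], the decomposition of an element of the sum need not be unique; the weight
   is therefore any scalar that works, and lam k + b a is a witness. *)
pose mu k := xget 0 [set c | [lie k, v] - c *: v \in W]%classic.
exists mu => h; rewrite /mu => /memv_addP[k Hk [_ /vlineP[b ->] ->]].
case: xgetP => [c -> //|/(_ (lam k + b * a)) []] /=.
rewrite lieDl lieZl scalerDl -scalerA opprD addrACA -scalerBr memvD ?vP ?memvZ //.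
by rewrite -adE.
Qed.

End LieTheorem.

(** * Generalized eigenspaces *)

Section GeneralizedEigenspaces.
Variables (K : numClosedFieldType) (V : vectType K).
Implicit Types (f h P : 'End(V)) (u v w : V) (a b : K) (U S : {vspace V}).

Definition lfun_pow f n : 'End(V) := iter n (comp_lfun f) \1%VF.

Lemma lfun_powE f n v : lfun_pow f n v = iter n f v.
Proof. by elim: n => [|n IHn]; rewrite /= ?id_lfunE // comp_lfunE IHn. Qed.

Lemma lker_powS f n : (lker (lfun_pow f n) <= lker (lfun_pow f n.+1))%VS.
Proof.
apply/subvP => v; rewrite !memv_ker !lfun_powE iterS => /eqP->.
by rewrite linear0.
Qed.

Lemma lker_pow_le f m n : (m <= n)%N -> (lker (lfun_pow f m) <= lker (lfun_pow f n))%VS.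
Proof.
move/subnKC <-; elim: (n - m)%N => [|k IHk]; first by rewrite addn0.
by rewrite addnS (subv_trans IHk) ?lker_powS.
Qed.

(** The kernels of the powers repeat at some k at most [\dim {:V}], and pulling this equality back
    along [f] propagates it. So the exponent [\dim {:V}] already gives the full generalized
    eigenspace. *)
Lemma lker_pow_dim f n : (lker (lfun_pow f n) <= lker (lfun_pow f (\dim {:V})))%VS.
Proof.
have [k le_k Uk] := chain_stationary (lker_powS f).
have stat m : lker (lfun_pow f (m + k)) = lker (lfun_pow f k).
  elim: m => // m IHm; rewrite -[RHS]Uk; apply/vspaceP => v.
  have := congr1 (fun U : {vspace V} => f v \in U) IHm.
  by rewrite !memv_ker !lfun_powE -!iterSr.
have [le_nk|lt_kn] := leqP n k; first exact: lker_pow_le (leq_trans le_nk le_k).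
by rewrite -(subnK (ltnW lt_kn)) stat lker_pow_le.
Qed.

Definition genspace f a := lker (lfun_pow (f - a *: \1%VF) (\dim {:V})).

Lemma shiftE f a v : (f - a *: \1%VF) v = f v - a *: v.
Proof. by rewrite add_lfunE opp_lfunE scale_lfunE id_lfunE. Qed.

Lemma genspaceP f a v :
  reflect (exists n, iter n (f - a *: \1)%VF v = 0) (v \in genspace f a).
Proof.
apply: (iffP idP) => [|[n vn]].
  by rewrite memv_ker lfun_powE => /eqP ?; exists (\dim {:V}).
by apply: (subvP (lker_pow_dim _ n)); rewrite memv_ker lfun_powE vn.
Qed.

Lemma genspace_shift f a v : f v - a *: v \in genspace f a -> v \in genspace f a.
Proof.
by move=> /genspaceP[n vn]; apply/genspaceP; exists n.+1; rewrite iterSr shiftE.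
Qed.

Lemma genspace_stable f a v : v \in genspace f a -> f v \in genspace f a.
Proof.
move=> Gv; rewrite -[f v](subrK (a *: v)) memvD ?memvZ //.
move/genspaceP: Gv => [n vn]; apply/genspaceP; exists n.
by rewrite -shiftE -iterSr iterS vn linear0.
Qed.

Lemma genspace_eq0 f a b v : v \in genspace f a -> f v = b *: v -> a != b -> v = 0.
Proof.
move=> /genspaceP[n vn] fv ab; apply/eqP; move: vn.
have -> : iter n (f - a *: \1%VF) v = (b - a) ^+ n *: v.
  elim: n => [|n IHn]; first by rewrite scale1r.
  by rewrite iterS IHn linearZ /= shiftE fv -scalerBl scalerA exprSr.
move=> /eqP; rewrite scaler_eq0 expf_eq0 subr_eq0 eq_sym (negPf ab) andbF //.
Qed.

(** The Fitting complement of [genspace f a]. *)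
Definition cogenspace f a := limg (lfun_pow (f - a *: \1%VF) (\dim {:V})).

Lemma cap_genspace f a : (genspace f a :&: cogenspace f a)%VS = 0%VS.
Proof.
apply/eqP; rewrite -subv0; apply/subvP => v /memv_capP[Gv /memv_imgP[w _ def_v]].
move: Gv; rewrite memv0 {v}def_v lfun_powE => /genspaceP[n].
rewrite -iterD => w0.
have /(subvP (lker_pow_dim _ _)) : w \in lker (lfun_pow (f - a *: \1)%VF (n + \dim {:V})).
  by rewrite memv_ker lfun_powE w0.
by rewrite memv_ker lfun_powE.
Qed.

Lemma add_genspace f a : (genspace f a + cogenspace f a)%VS = {:V}%VS.
Proof.
apply/eqP; rewrite eqEdim subvf dimv_disjoint_sum ?cap_genspace //.
have := limg_ker_dim (lfun_pow (f - a *: \1%VF) (\dim {:V})) fullv.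
by rewrite capfv -/(genspace f a) -/(cogenspace f a) => ->; rewrite leqnn.
Qed.

Definition genproj f a := daddv_pi (genspace f a) (cogenspace f a).

Lemma memv_genproj f a v : genproj f a v \in genspace f a.
Proof. exact: memv_pi. Qed.

Lemma genproj_id f a v : v \in genspace f a -> genproj f a v = v.
Proof. by apply: daddv_pi_id; apply: cap_genspace. Qed.

Lemma memv_genprojC f a v : v - genproj f a v \in cogenspace f a.
Proof.
have := @daddv_pi_add _ _ _ _ v (cap_genspace f a); rewrite add_genspace => /(_ (memvf _)).
by move/(canRL (addKr _)); rewrite addrC => <-; apply: memv_pi.
Qed.

Lemma genproj_co f a v : v \in cogenspace f a -> genproj f a v = 0.
Proof.
move=> Mv; apply/eqP; rewrite -memv0 -(cap_genspace f a) memv_cap memv_genproj.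
by rewrite -[genproj f a v](subKr v) memvB ?memv_genprojC.
Qed.

(** On [genspace f b] the map f - a is injective, hence onto, so each vector there is in the image
    of every power of f - a. *)
Lemma genspace_co f a b : a != b -> (genspace f b <= cogenspace f a)%VS.
Proof.
move=> ab; set N := f - a *: \1%VF.
have NG : (N @: genspace f b)%VS = genspace f b.
  apply/eqP; rewrite eqEdim limg_dim_eq ?leqnn ?andbT.
    by apply/subvP => _ /memv_imgP[v Gv ->]; rewrite shiftE memvB ?memvZ ?genspace_stable.
  apply/eqP; rewrite -subv0; apply/subvP => v /memv_capP[Gv]; rewrite memv_ker shiftE.
  by rewrite subr_eq0 memv0 => /eqP fv; rewrite (genspace_eq0 Gv fv) // eq_sym.
rewrite /cogenspace -/N; suff NnG n : (lfun_pow N n @: genspace f b)%VS = genspace f b.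
  by rewrite -{1}(NnG (\dim {:V})) limgS ?subvf.
by elim: n => [|n IHn]; rewrite ?lim1g //= limg_comp IHn.
Qed.

Lemma genproj_neq f a b v : v \in genspace f b -> a != b -> genproj f a v = 0.
Proof. by move=> Gv ab; rewrite genproj_co //; apply: subvP (genspace_co f ab) _ Gv. Qed.

(** Allows a factor f - a to be cancelled modulo [S]. On the Fitting complement f - a is injective,
    so it maps the part of [S] lying there onto itself; the other component is in [S] by
    assumption. *)
Lemma genspace_saturated f a S v :
    {in S, forall u, f u \in S} -> (genspace f a <= S)%VS ->
  f v - a *: v \in S -> v \in S.
Proof.
move=> fS GS Nv; set N := f - a *: \1%VF; set M := cogenspace f a.
have NM w : w \in M -> N w \in M.
  move=> /memv_imgP[u _ ->]; rewrite lfun_powE -iterS iterSr -lfun_powE.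
  by rewrite memv_img ?memvf.
have injN w : w \in M -> N w = 0 -> w = 0.
  move=> Mw Nw; apply/eqP; rewrite -memv0 -(cap_genspace f a) memv_cap Mw andbT.
  by apply/genspaceP; exists 1%N.
have NSM : (N @: (S :&: M))%VS = (S :&: M)%VS.
  apply/eqP; rewrite eqEdim limg_dim_eq ?leqnn ?andbT.
    apply/subvP => _ /memv_imgP[w /memv_capP[Sw Mw] ->].
    by rewrite memv_cap NM // shiftE memvB ?memvZ ?fS.
  apply/eqP; rewrite -subv0; apply/subvP => w /memv_capP[/memv_capP[_ Mw]].
  by rewrite memv_ker memv0 => /eqP /injN -> //.
rewrite -[v](subrK (genproj f a v)); set m := v - _.
have Sp : genproj f a v \in S by apply: subvP GS _ (memv_genproj _ _ _).
have Mm : m \in M := memv_genprojC f a v.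
have : N m \in (N @: (S :&: M))%VS.
  rewrite NSM memv_cap NM // andbT linearB /= !shiftE.
  by rewrite memvB // memvB ?memvZ ?fS.
case/memv_imgP => m' /memv_capP[Sm' Mm'] Nmm'; rewrite memvD //.
suff /eqP : m - m' = 0 by rewrite subr_eq0 => /eqP->.
by apply: injN; [exact: memvB | rewrite linearB /= Nmm' subrr].
Qed.

Lemma genproj_sum f : exists2 s, uniq s & \sum_(a <- s) genproj f a = \1%VF.
Proof.
have [r rP] := eigen_annihilator f; exists (undup r); first exact: undup_uniq.
set S := (\sum_(a <- undup r) genspace f a)%VS.
have GS a : a \in r -> (genspace f a <= S)%VS.
  by rewrite -mem_undup /S => ra; rewrite (big_rem a) //= addvSl.
have S_ind X : (forall a, a \in r -> (genspace f a <= X)%VS) -> (S <= X)%VS.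
  move=> GX; rewrite /S big_seq; apply: (big_ind (fun U : {vspace V} => U <= X)%VS) =>
      [|U U' UX UX'|a]; first exact: sub0v.
    by rewrite subv_add UX.
  by rewrite mem_undup => /GX.
have fS : {in S, forall u, f u \in S}.
  suff /subvP fS : (S <= f @^-1: S)%VS by move=> u /fS; rewrite memv_preim.
  apply: S_ind => a ra; apply/subvP => v Gv; rewrite -memv_preim.
  by apply: (subvP (GS _ ra)); apply: genspace_stable.
(* The factors indexed by [r] drive [v] to 0, which is in [S]; saturation undoes them one by one. *)
have Sfull v : v \in S.
  have sub_r : {subset r <= r} by [].
  move: v (rP v); elim: {1 3}r sub_r => [|a q IHq] sub_r v /= v0; first by rewrite v0 mem0v.
  apply: (@genspace_saturated f a) => //; first by rewrite GS ?sub_r ?mem_head.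
  by apply: IHq => // b qb; rewrite sub_r ?inE ?qb ?orbT.
apply/lfunP => v; apply/eqlfunP; apply: subvP (Sfull v); apply: S_ind => a ra.
apply/subvP => u Gu; apply/eqlfunP.
rewrite sum_lfunE id_lfunE (bigD1_seq a) ?undup_uniq ?mem_undup //=.
rewrite genproj_id // big1 ?addr0 // => b ab.
exact: genproj_neq Gu ab.
Qed.

Lemma genspace_span f S : (forall a, (genspace f a <= S)%VS) -> S = {:V}%VS.
Proof.
move=> GS; apply/eqP; rewrite eqEsubv subvf; apply/subvP => v _.
have [s _ /(congr1 (fun h : 'End(V) => h v))] := genproj_sum f.
rewrite sum_lfunE id_lfunE => <-; apply: memv_suml => a _.
exact: subvP (GS a) _ (memv_genproj _ _ _).
Qed.

(** The trace of a restriction does not depend on the complement chosen, so [genproj] may replace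
    [projv]. *)
Lemma lftrace_proj P U f : (forall v, P v \in U) -> {in U, forall v, P v = v} ->
  {in U, forall v, f v \in U} -> lftrace (f \o P)%VF = lftrace_on U f.
Proof.
move=> PU Pid fU.
have -> : (f \o P = projv U \o (f \o P))%VF.
  by apply/lfunP => v; rewrite !comp_lfunE projv_id ?fU.
rewrite lftraceC -comp_lfunA; congr (lftrace (_ \o _)%VF).
by apply/lfunP => v; rewrite comp_lfunE Pid ?memv_proj.
Qed.

(** f - a maps the kernel of each of its powers into the previous kernel, hence has trace zero
    there. *)
Lemma lftrace_genspace f a : lftrace_on (genspace f a) f = a * (\dim (genspace f a))%:R.
Proof.
set N := f - a *: \1%VF.
suff trN n : lftrace_on (lker (lfun_pow N n)) N = 0.
  have := trN (\dim {:V}); rewrite -/(genspace f a) /N linearB linearZ /= lftrace_on1.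
  by move/eqP; rewrite subr_eq0 => /eqP.
elim: n => [|n <-]; last first.
  apply: lftrace_on_sub (lker_powS _ _); apply/subvP => _ /memv_imgP[v Kv ->].
  by move: Kv; rewrite !memv_ker !lfun_powE -iterSr.
rewrite /lftrace_on; set Q := (N \o _)%VF; suff -> : Q = 0 by rewrite linear0.
apply/lfunP => v; rewrite zero_lfunE comp_lfunE.
have := memv_proj (lker (lfun_pow N 0)) v; rewrite memv_ker lfun_powE /= => /eqP->.
by rewrite linear0.
Qed.

Lemma lftrace_genproj f a : lftrace (f \o genproj f a)%VF = a * (\dim (genspace f a))%:R.
Proof.
rewrite (@lftrace_proj _ (genspace f a)) ?lftrace_genspace //.
- exact: memv_genproj.
- exact: genproj_id.
- exact: genspace_stable.
Qed.

Lemma lftrace_genproj1 f a : lftrace (genproj f a) = (\dim (genspace f a))%:R.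
Proof.
rewrite -[genproj f a]comp_lfun1l (@lftrace_proj _ (genspace f a)) ?lftrace_on1 //.
- exact: memv_genproj.
- exact: genproj_id.
- by move=> v; rewrite id_lfunE.
Qed.

(** Size and sum come from taking traces in 1 = sum of the [genproj f a] and in its composite with
    [f]; the equality of sizes is proved in [K], by characteristic 0. *)
Lemma weight_multiset f : exists t : seq K,
  [/\ size t = \dim {:V}, \sum_(a <- t) a = lftrace f
    & forall a, \dim (genspace f a) = count_mem a t].
Proof.
have [s Us defs] := genproj_sum f.
exists (flatten [seq nseq (\dim (genspace f a)) a | a <- s]); split.
- rewrite size_flatten /shape -map_comp sumnE big_map.
  apply/eqP; rewrite -(eqr_nat K) natr_sum.
  have <- : lftrace (\1%VF : 'End(V)) = (\dim {:V})%:R :> K.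
    by rewrite lftrace_idem ?comp_lfun1l ?lim1g.
  rewrite -defs linear_sum /=; apply/eqP/eq_bigr => a _.
  by rewrite size_nseq lftrace_genproj1.
- rewrite big_flatten big_map -[f in RHS]comp_lfun1r -defs.
  have -> : (f \o \sum_(a <- s) genproj f a = \sum_(a <- s) (f \o genproj f a))%VF.
    apply/lfunP => v; rewrite comp_lfunE !sum_lfunE linear_sum.
    by apply: eq_bigr => a _; rewrite comp_lfunE.
  rewrite linear_sum /=; apply: eq_bigr => a _.
  by rewrite lftrace_genproj big_nseq mulr_natr iter_addr addr0.
move=> b; rewrite count_flatten -map_comp sumnE big_map.
rewrite (eq_bigr (fun a => ((a == b) * \dim (genspace f a))%N)); last first.
  by move=> a _; rewrite /= count_nseq.
have [sb|notsb] := boolP (b \in s).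
  rewrite (bigD1_seq b) //= eqxx mul1n big1 ?addn0 // => a /negPf->.
  by rewrite mul0n.
rewrite big_seq big1 => [|a sa]; last first.
  by rewrite (negPf (memPn notsb a sa)).
apply/eqP; rewrite dimv_eq0 -subv0; apply/subvP => v Gv.
have := congr1 (fun h : 'End(V) => h v) defs; rewrite sum_lfunE id_lfunE memv0 => <-.
rewrite big_seq big1 // => a sa; apply: genproj_neq Gv _.
exact: memPn notsb a sa.
Qed.

End GeneralizedEigenspaces.

(** * The derived algebra and an element of it with non-nilpotent adjoint *)

Section Derived.
Variables (K : numClosedFieldType) (g : finLieAlgType K).
Implicit Types (x y z u v : g) (a b : K) (U : {vspace g}).

Definition derived : {vspace g} :=
  (\sum_(i < \dim {:g}) ad (vbasis {:g})`_i @: fullv)%VS.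

Lemma mem_derived x y : [lie x, y] \in derived.
Proof.
rewrite [x](coord_vbasis (memvf x)) -adE linear_sum sum_lfunE.
apply: memv_sumr => i _; rewrite linearZ scale_lfunE memvZ //.
by rewrite memv_img ?memvf.
Qed.

Lemma derived_sub U : (forall x y, [lie x, y] \in U) -> (derived <= U)%VS.
Proof.
move=> lieU; apply/subv_sumP => i _; apply/subvP => _ /memv_imgP[y _ ->].
by rewrite adE.
Qed.

Lemma lftrace_ad_derived x : x \in derived -> lftrace (ad x) = 0.
Proof.
pose X := lker (linfun (@lftrace _ g \o @ad _ g : g -> K^o)).
suff /subvP sDX : (derived <= X)%VS by move=> /sDX; rewrite memv_ker lfunE => /eqP.
apply: derived_sub => y z; rewrite memv_ker lfunE /= ad_lie linearB /=.
by rewrite lftraceC subrr.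
Qed.

(** Every subspace containing [derived] is an ideal, so the chain continues by adding basis vectors
    one at a time. *)
Lemma lie_solvable_derived : lie_solvable derived -> lie_solvable {:g}.
Proof.
move=> solD; have <- : (derived + <<vbasis {:g}>>)%VS = {:g}%VS.
  by rewrite (span_basis (vbasisP _)) addvf.
elim: (tval _) => [|y X IHX]; first by rewrite span_nil addv0.
rewrite span_cons [X in (_ + X)%VS]addvC addvA; apply: LieSolvableD IHX _ => k _.
exact: subvP (addvSl _ _) _ (mem_derived _ _).
Qed.

Lemma maximal_solvable_sub U : exists2 B, lie_solvable B /\ (B <= U)%VS &
  forall y, y \in U -> y \notin B -> ~ lie_solvable (B + <[y]>)%VS.
Proof.
suff: forall n B, lie_solvable B -> (B <= U)%VS -> (\dim U - \dim B <= n)%N ->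
    exists2 B, lie_solvable B /\ (B <= U)%VS &
      forall y, y \in U -> y \notin B -> ~ lie_solvable (B + <[y]>)%VS.
  by move=> /(_ _ 0%VS (LieSolvable0 _) (sub0v _) (leqnn _)).
elim=> [|n IHn] B solB BU dimB.
  exists B => // y Uy; rewrite (_ : B = U) ?Uy //.
  by apply/eqP; rewrite eqEdim BU -subn_eq0 -leqn0.
have [[y [Uy By solBy]]|noy] := pselect (exists y, [/\ y \in U,
    y \notin B & lie_solvable (B + <[y]>)]).
  apply: (IHn (B + <[y]>)%VS) => //; first by rewrite subv_add BU.
  have : (\dim B < \dim (B + <[y]>))%N.
    rewrite (ltn_leqif (dimv_leqif_sup (addvSl _ _))).
    by apply: contra By => /subvP; apply; apply/(subvP (addvSr _ _))/memv_line.
  by move=> ltB; lia.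
by exists B => // y Uy By solBy; apply: noy; exists y.
Qed.

(** If the weight [lam] given by Lie's theorem on [derived] modulo [B] vanished, [y] would normalize
    [B] and B + <y> would be a larger solvable subalgebra. *)
Lemma nonsolvable_eigenvector : ~ lie_solvable {:g} ->
  exists x y a (B : {vspace g}), [/\ x \in derived, a != 0, y \notin B,
    {in B, forall z, [lie x, z] \in B} & [lie x, y] - a *: y \in B].
Proof.
move=> nsol; have [B [solB BD] maxB] := maximal_solvable_sub derived.
have DB : ~~ (derived <= B)%VS.
  apply: contra_notN nsol => DB; apply: lie_solvable_derived.
  by rewrite (_ : derived = B) //; apply/eqP; rewrite eqEsubv DB.
have sBB := lie_solvable_subalg solB.
have [|y [Dy By] [lam lamP]] := lie_eigenvector solB _ sBB BD DB.
  by move=> h u _ _; apply: mem_derived.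
have [[x [Bx lamx]]|lam0] := pselect (exists x, x \in B /\ lam x != 0).
  exists x, y, (lam x), B; split; rewrite ?(subvP BD) ?lamP //.
  by move=> b; apply: sBB.
case: (maxB _ Dy By); apply: LieSolvableD => // k Bk.
have [lamk|lamk] := eqVneq (lam k) 0; last by case: lam0; exists k.
by have := lamP _ Bk; rewrite lamk scale0r subr0 lieC memvN.
Qed.

(** Were 0 the only weight, some power of [ad x] would kill [y], but modulo [B] the n-th power
    multiplies [y] by a^n. *)
Lemma nonsolvable_ad : ~ lie_solvable {:g} ->
  exists x a, [/\ x \in derived, a != 0 & genspace (ad x) a != 0%VS].
Proof.
move=> /nonsolvable_eigenvector[x [y [a [B [Dx a0 By xB xy]]]]].
suff [b [b0 Gb]] : exists b, b != 0 /\ genspace (ad x) b != 0%VS by exists x, b.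
apply: contrapT => /forallNP noG.
have G0 : genspace (ad x) 0 = {:g}%VS.
  apply: (genspace_span (f := ad x)) => b; have [->//|b0] := eqVneq b 0.
  have [->|Gb] := eqVneq (genspace (ad x) b) 0%VS; first exact: sub0v.
  by case: (noG b).
have /genspaceP[n] : y \in genspace (ad x) 0 by rewrite G0 memvf.
rewrite scale0r subr0 => yn0.
suff xn : iter n (ad x) y - a ^+ n *: y \in B.
  move: xn; rewrite yn0 sub0r memvN => /(memvZ (a ^+ n)^-1).
  by rewrite scalerA mulVf ?expf_neq0 // scale1r (negPf By).
elim: n {yn0} => [|n IHn]; first by rewrite scale1r subrr mem0v.
rewrite iterS -[iter n _ y](subrK (a ^+ n *: y)) linearD /= -addrA.
by rewrite memvD ?adE ?xB // lieZr exprSr -scalerA -scalerBr memvZ.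
Qed.

(** * Weight spaces of [ad x] and opposite root vectors *)

Section Roots.
Variable x : g.
Let G a := genspace (ad x) a.

(** By the Leibniz rule, each application of [ad x] - (a + b) lowers the exponent needed by one of
    the two factors; hence the double induction and the exponent m + n. *)
Lemma genspace_lie a b u v : u \in G a -> v \in G b -> [lie u, v] \in G (a + b).
Proof.
move=> /genspaceP[m um] /genspaceP[n vn]; apply/genspaceP; exists (m + n)%N.
elim: m n u v um vn => [|m IHm] n u v; first by rewrite /= => -> _;
    rewrite lie0l iter_fix ?linear0.
move=> um; elim: n v => [|n IHn] v vn.
  by rewrite /= in vn; rewrite vn lie0r iter_fix ?linear0.
rewrite addSn iterSr.
have -> : (ad x - (a + b) *: \1)%VF [lie u, v] =
    [lie (ad x - a *: \1)%VF u, v] + [lie u, (ad x - b *: \1)%VF v].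
  rewrite !shiftE !adE lie_der lieDl lieDr lieNl lieNr lieZl lieZr scalerDl opprD.
  by rewrite addrACA.
have iterD k w1 w2 (f : 'End(g)) : iter k f (w1 + w2) = iter k f w1 + iter k f w2.
  by rewrite -!lfun_powE linearD.
by rewrite iterD IHm -?iterSr // add0r addnS -addSn IHn // -iterSr.

Qed.

Lemma genspace_self : x \in G 0.
Proof. by apply: genspace_shift; rewrite adE liexx scale0r subr0 mem0v. Qed.

(** [ad z] sends [G a] into [G (c + a)], which the projection onto [G a] kills. *)
Lemma lftrace_ad_shift a c z : c != 0 -> z \in G c ->
  lftrace (ad z \o genproj (ad x) a)%VF = 0.
Proof.
move=> c0 Gz; set P := genproj _ _.
have -> : (ad z \o P = (ad z \o P) \o P)%VF.
  by apply/lfunP => v; rewrite !comp_lfunE [P (P v)]genproj_id ?memv_genproj.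
rewrite lftraceC (_ : (_ \o _)%VF = 0) ?linear0 //.
apply/lfunP => v; rewrite !comp_lfunE zero_lfunE adE.
apply: (@genproj_neq _ _ (ad x) a (c + a)); first by rewrite genspace_lie ?memv_genproj.
by rewrite eq_sym -subr_eq0 addrK.
Qed.

(* The functional [z |-> tr (ad z restricted to G a)] is nonzero at [x], but kills
   [G b, G c] unless [b + c = 0], and [G 0, G 0]. *)
Lemma root_pair a : x \in derived -> a != 0 -> G a != 0%VS ->
  exists b e f, [/\ b != 0, e \in G b, f \in G (- b) &
    lftrace (ad [lie e, f] \o genproj (ad x) a)%VF != 0].
Proof.
move=> Dx a0 Ga; apply: contrapT => noroot.
pose phi z : K^o := lftrace (ad z \o genproj (ad x) a)%VF.
have phi_lin : linear phi.
  by move=> c u v; rewrite /phi linearP comp_lfunDl -comp_lfunZl linearP.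
pose phiM := GRing.isLinear.Build _ _ _ _ phi phi_lin.
pose phiL : {linear g -> K^o} := HB.pack phi phiM.
pose X := lker (linfun phiL).
have XE z : (z \in X) = (phi z == 0) by rewrite memv_ker lfunE.
have hom b c p q : p \in G b -> q \in G c -> [lie p, q] \in X.
  move=> Gp Gq; rewrite XE /phi; have [bc|bc] := eqVneq (b + c) 0; last first.
    by rewrite (lftrace_ad_shift _ bc) // genspace_lie.
  have [b0|b0] := eqVneq b 0.
    rewrite ad_lie lftrace_comm //.
      apply/lfunP => v; rewrite !comp_lfunE !adE [RHS]genproj_id //.
      by have := genspace_lie Gp (memv_genproj (ad x) a v); rewrite b0 add0r.
    apply/lfunP => v; rewrite !comp_lfunE !adE [RHS]genproj_id //.
    have c0 : c = 0 by move: bc; rewrite b0 add0r.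
    by have := genspace_lie Gq (memv_genproj (ad x) a v); rewrite c0 add0r.
  apply: contra_notT noroot => nz; exists b, p, q; split => //.
  by rewrite (_ : - b = c) //; apply/esym/eqP; rewrite -addr_eq0 addrC bc.
have hom1 b p q : p \in G b -> [lie p, q] \in X.
  move=> Gp; rewrite -adE memv_preim.
  rewrite (genspace_span (f := ad x) (S := ad p @^-1: X)) ?memvf // => c.
  by apply/subvP => v Gv; rewrite -memv_preim adE; apply: hom Gp Gv.
have : x \in X.
  apply: subvP Dx; apply: derived_sub => p q; rewrite lieC memvN -adE memv_preim.
  rewrite (genspace_span (f := ad x) (S := ad q @^-1: X)) ?memvf // => c.
  by apply/subvP => v Gv; rewrite -memv_preim adE lieC memvN; apply: hom1 Gv.
rewrite XE /phi lftrace_genproj mulf_eq0 (negPf a0) pnatr_eq0 dimv_eq0.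
exact/negP.
Qed.

Lemma root_dims a e f : \dim {:g} = 5%N -> x \in derived -> a != 0 ->
    e \in G a -> f \in G (- a) -> [lie e, f] != 0 ->
  exists m, forall b, \dim (G b) = count_mem b [:: 0; a; - a; m; - m].
Proof.
move=> dimg Dx a0 Ge Gf ef; have [t [sz sum_t dimt]] := weight_multiset (ad x).
have memt b u : u \in G b -> u != 0 -> b \in t.
  move=> Gu u0; rewrite -has_pred1 has_count -dimt lt0n dimv_eq0.
  by apply: contra u0 => /eqP G0; move: Gu; rewrite /G G0 memv0.
have t0 : 0 \in t.
  have := genspace_lie Ge Gf; rewrite subrr => Gh; exact: memt Gh ef.
have ta : a \in t by apply: memt Ge _; apply: contraNneq ef => ->; rewrite lie0l.
have tna : - a \in t by apply: memt Gf _; apply: contraNneq ef => ->; rewrite lie0r.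
have ana : - a != a by rewrite eq_sym -subr_eq0 opprK -mulr2n mulrn_eq0.
have p1 := perm_to_rem t0.
have ta' : a \in rem 0 t by move: ta; rewrite (perm_mem p1) inE (negPf a0).
have p2 := perm_to_rem ta'.
have tna' : - a \in rem a (rem 0 t).
  move: tna; rewrite (perm_mem p1) inE oppr_eq0 (negPf a0) /=.
  by rewrite (perm_mem p2) inE (negPf ana).
have p3 := perm_to_rem tna'.
have pt : perm_eq t [:: 0, a, - a & rem (- a) (rem a (rem 0 t))].
  by rewrite (permPl p1) perm_cons (permPl p2) perm_cons.
have := perm_size pt; rewrite sz dimg; move: pt.
case: (rem _ _) => [|m [|n []]] //= pt _; exists m => b; rewrite /G dimt (permP pt).
move: sum_t; rewrite (perm_big _ pt) /= !big_cons big_nil lftrace_ad_derived // addr0 add0r.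
by rewrite addrA subrr add0r => /eqP; rewrite addrC addr_eq0 => /eqP ->.
Qed.

End Roots.
End Derived.

(** * Recognizing the four algebras *)

(** Explicit maps are easiest to define from the matrix models into [g]; the inverse is obtained by
    choice. *)
Lemma lie_isog_inv (K : fieldType) (L1 L2 : lieAlgType K) (h : {linear L2 -> L1}) :
    injective h -> (forall v, exists w, h w = v) ->
    (forall x y, h [lie x, y] = [lie h x, h y]) ->
  lie_isog L1 L2.
Proof.
move=> inj_h surj_h lie_h.
pose k v := xget 0 [set w | h w = v]%classic.
have kK : cancel k h by move=> v; rewrite /k; case: xgetP => // /= noh;
    case: (surj_h v) => w /noh.
have hK : cancel h k by move=> w; apply: inj_h; rewrite kK.
have k_lin : linear k by move=> a u v; apply: inj_h; rewrite linearP !kK.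
pose kM := GRing.isLinear.Build _ _ _ _ k k_lin.
exists (HB.pack k kM : {linear L1 -> L2}); split; first by exists h.
by move=> x y; apply: inj_h; rewrite lie_h /= !kK.
Qed.

Section Combinations.
Variables (K : fieldType) (V : lmodType K).
Implicit Types (x y z : V) (a b c k : K).

(** Fixed-length combinations turn bracket identities into identities of coefficients, left to
    [ring]. *)
Definition comb2 x y a b : V := a *: x + b *: y.
Definition comb3 x y z a b c : V := comb2 x y a b + c *: z.

Lemma comb2D x y a b a' b' :
  comb2 x y a b + comb2 x y a' b' = comb2 x y (a + a') (b + b').
Proof. by rewrite /comb2 addrACA -!scalerDl. Qed.

Lemma comb2Z x y k a b : k *: comb2 x y a b = comb2 x y (k * a) (k * b).
Proof. by rewrite /comb2 scalerDr !scalerA. Qed.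

Lemma comb3D x y z a b c a' b' c' :
  comb3 x y z a b c + comb3 x y z a' b' c' = comb3 x y z (a + a') (b + b') (c + c').
Proof. by rewrite /comb3 addrACA comb2D -scalerDl. Qed.

Lemma comb3Z x y z k a b c : k *: comb3 x y z a b c = comb3 x y z (k * a) (k * b) (k * c).
Proof. by rewrite /comb3 scalerDr comb2Z scalerA. Qed.

Lemma comb2N x y a b : - comb2 x y a b = comb2 x y (- a) (- b).
Proof. by rewrite -scaleN1r comb2Z !mulN1r. Qed.

Lemma comb20 x y : comb2 x y 0 0 = 0.
Proof. by rewrite /comb2 !scale0r addr0. Qed.

Lemma comb30 x y z : comb3 x y z 0 0 0 = 0.
Proof. by rewrite /comb3 comb20 scale0r addr0. Qed.

End Combinations.

Lemma linear_comb2 (K : fieldType) (V W : lmodType K) (P : {linear V -> W}) x y a b :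
  P (comb2 x y a b) = comb2 (P x) (P y) a b.
Proof. by rewrite /comb2 linearD !linearZ. Qed.

Lemma linear_comb3 (K : fieldType) (V W : lmodType K) (P : {linear V -> W}) x y z a b c :
  P (comb3 x y z a b c) = comb3 (P x) (P y) (P z) a b c.
Proof. by rewrite /comb3 linearD linearZ linear_comb2. Qed.

Section ConcreteAlgebras.
Variables (K : fieldType).
Local Notation i0 := ord0.
Local Notation i1 := (lift ord0 ord0).
Local Notation i2 := (lift ord0 (lift ord0 ord0)).

Definition sl2_triple (L : lieAlgType K) (e f h : L) :=
  [/\ [lie h, e] = 2 *: e, [lie h, f] = (- 2) *: f & [lie e, f] = h].

Lemma sl2_trace (A : sl K 2) : val A i1 i1 = - val A i0 i0.
Proof.
apply/eqP; rewrite -addr_eq0 addrC.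
have := valP A; rewrite inE => /eqP <-.
by rewrite /mxtrace !big_ord_recl big_ord0 addr0.
Qed.

Section FromSl2.
Variables (L : lieAlgType K) (e f h : L).
Hypothesis efh : sl2_triple e f h.

Definition of_sl2 (A : sl K 2) : L := comb3 e f h (val A i0 i1) (val A i1 i0) (val A i0 i0).

Fact of_sl2_linear : linear of_sl2.
Proof. by move=> a A B; rewrite /of_sl2 comb3Z comb3D linearP /= !mxE. Qed.
HB.instance Definition _ := GRing.isLinear.Build K (sl K 2) L _ of_sl2 of_sl2_linear.

Lemma of_sl2_lie A B : of_sl2 [lie A, B] = [lie of_sl2 A, of_sl2 B].
Proof.
have [he hf ef] := efh.
have E_he : [lie h, e] = comb3 e f h 2 0 0 by rewrite he /comb3 /comb2 !scale0r !addr0.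
have E_hf : [lie h, f] = comb3 e f h 0 (- 2) 0 by rewrite hf /comb3 /comb2 !scale0r !(addr0,
    add0r).
have E_ef : [lie e, f] = comb3 e f h 0 0 1 by rewrite ef /comb3 comb20 scale1r add0r.
rewrite /of_sl2 [in RHS]/comb3 [in RHS]/comb2 !lieDl !lieDr !lieZl !lieZr !liexx.
(* Zero brackets are also written as a [comb3], so that everything merges into a single
   combination. *)
rewrite (lieC f e) (lieC e h) (lieC f h) -(comb30 e f h) E_he E_hf E_ef.
rewrite -!(scaleN1r (comb3 _ _ _ _ _ _)) !comb3Z !comb3D /=.
rewrite !mxE !big_ord_recl !big_ord0 !sl2_trace /=.
congr comb3; ring.
Qed.

End FromSl2.

Lemma sl2_of_entries (a b c : K) :
  exists A : sl K 2, [/\ val A i0 i1 = a, val A i1 i0 = b & val A i0 i0 = c].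
Proof.
pose M : 'M[K]_2 := \matrix_(i, j)
  (if i == i0 then (if j == i0 then c else a) else (if j == i0 then b else - c)).
have trM : M \in lieSubalg_pred (LieSubalg (@traceless_submod K 2) (@traceless_lie K 2)).
  by rewrite inE /mxtrace !big_ord_recl big_ord0 !mxE /= addr0 subrr.
by exists (LieSub trM); split; rewrite /= mxE.
Qed.

Lemma sl2_eq0 (A : sl K 2) :
  val A i0 i1 = 0 -> val A i1 i0 = 0 -> val A i0 i0 = 0 -> A = 0.
Proof.
move=> A01 A10 A00; apply/val_inj/matrixP => i j; rewrite [RHS]mxE.
case: (unliftP i0 i) => [i'|] ->; case: (unliftP i0 j) => [j'|] -> //; rewrite ?ord1 //.
by rewrite sl2_trace A00 oppr0.
Qed.

Section DirectProduct.
Variables (g : lieAlgType K) (e f h : g) (L : lieAlgType K) (theta : {linear L -> g}).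
Hypothesis efh : sl2_triple e f h.
Hypothesis theta_lie : forall x y, theta [lie x, y] = [lie theta x, theta y].
Hypothesis theta_cent : forall x,
  [/\ [lie e, theta x] = 0, [lie f, theta x] = 0 & [lie h, theta x] = 0].
Hypothesis gen : forall v, exists a b c x, v = comb3 e f h a b c + theta x.
Hypothesis indep : forall a b c x, comb3 e f h a b c + theta x = 0 ->
  [/\ a = 0, b = 0, c = 0 & x = 0].

Lemma lie_isog_sl2_prod : lie_isog g (sl K 2 * L)%type.
Proof.
pose F (w : sl K 2 * L) : g := of_sl2 e f h w.1 + theta w.2.
have F_lin : linear F.
  by move=> a u v; rewrite /F /= !linearP scalerDr addrACA.
pose FM := GRing.isLinear.Build _ _ _ _ F F_lin.
have cent A x : [lie of_sl2 e f h A, theta x] = 0.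
  have [ex fx hx] := theta_cent x.
  by rewrite !lieDl !lieZl ex fx hx !scaler0 !addr0.
apply: (@lie_isog_inv _ _ _ (HB.pack F FM : {linear (sl K 2 * L)%type -> g})) => /=.
- move=> u v /eqP; rewrite -subr_eq0 -(linearB (HB.pack F FM : {linear (sl K 2 * L)%type ->
    g})).
  move=> /eqP/indep[A01 A10 A00 x0]; apply/eqP; rewrite -subr_eq0; apply/eqP.
  by rewrite [LHS]surjective_pairing x0 (sl2_eq0 A01 A10 A00).
- move=> v; have [a [b [c [x ->]]]] := gen v.
  by have [A [A01 A10 A00]] := sl2_of_entries a b c; exists (A, x);
      rewrite /F /of_sl2 /= A01 A10 A00.
move=> [A x] [B y]; rewrite /F /= of_sl2_lie // theta_lie (lieDl (of_sl2 _ _ _ A))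
    !(lieDr (of_sl2 _ _ _ B)) cent.
by rewrite (lieC (theta x) (of_sl2 _ _ _ _)) cent oppr0 addr0 add0r.
Qed.

End DirectProduct.

Section Semidirect.
Variables (g : lieAlgType K) (e f h u w : g).
Hypothesis efh : sl2_triple e f h.
Hypotheses (eu : [lie e, u] = 0) (ew : [lie e, w] = u) (fu : [lie f, u] = w)
  (fw : [lie f, w] = 0) (hu : [lie h, u] = u) (hw : [lie h, w] = - w) (uw : [lie u, w] = 0).
Hypothesis gen : forall v, exists a b c p q, v = comb3 e f h a b c + comb2 u w p q.
Hypothesis indep : forall a b c p q, comb3 e f h a b c + comb2 u w p q = 0 ->
  [/\ a = 0, b = 0, c = 0, p = 0 & q = 0].

(** [u] and [w] are the images of the two standard basis columns. *)
Lemma lie_isog_sl2_std : lie_isog g (semidirect (sl_std K 2)).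
Proof.
pose theta (v : 'cV[K]_2) := comb2 u w (v i0 0) (v i1 0).
have theta_lin : linear theta by move=> a v1 v2; rewrite /theta comb2Z comb2D !mxE.
pose F (x : semidirect (sl_std K 2)) : g := of_sl2 e f h x.1 + theta x.2.
have F_lin : linear F.
  move=> a x y; rewrite /F.
  have [-> ->] : (a *: x + y).1 = a *: x.1 + y.1 /\ (a *: x + y).2 = a *: x.2 + y.2 by [].
  by rewrite of_sl2_linear theta_lin [in RHS]scalerDr addrACA.
pose FM := GRing.isLinear.Build _ _ _ _ F F_lin.
pose FL : {linear semidirect (sl_std K 2) -> g} := HB.pack F FM.
have act A v : [lie of_sl2 e f h A, theta v] = theta (val A *m v).
  have E_eu : [lie e, u] = comb2 u w 0 0 by rewrite comb20.
  have E_fw : [lie f, w] = comb2 u w 0 0 by rewrite comb20.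
  have E_ew : [lie e, w] = comb2 u w 1 0 by rewrite /comb2 scale1r scale0r addr0.
  have E_fu : [lie f, u] = comb2 u w 0 1 by rewrite /comb2 scale1r scale0r add0r.
  have E_hu : [lie h, u] = comb2 u w 1 0 by rewrite /comb2 scale1r scale0r addr0.
  have E_hw : [lie h, w] = comb2 u w 0 (- 1) by rewrite /comb2 scaleN1r scale0r add0r.
  rewrite /of_sl2 /theta [in LHS]/comb3 ![in LHS]/comb2 !lieDl !lieDr !lieZl !lieZr.
  rewrite E_eu E_fw E_ew E_fu E_hu E_hw !comb2Z !comb2D !mxE !big_ord_recl !big_ord0 sl2_trace.
  congr comb2; ring.
have ab v v' : [lie theta v, theta v'] = 0.
  rewrite /theta /comb2 !lieDl !lieDr !lieZl !lieZr (lieC w) uw !liexx oppr0.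
  by rewrite !scaler0 !addr0.
apply: (@lie_isog_inv _ _ _ FL) => /=.
- move=> x y /eqP; rewrite -subr_eq0 -(linearB FL).
  move=> /eqP/indep[A01 A10 A00 p0 q0]; apply/eqP; rewrite -subr_eq0; apply/eqP.
  rewrite [LHS]surjective_pairing (sl2_eq0 A01 A10 A00); congr pair.
  apply/matrixP => i j; rewrite ord1 [RHS]mxE.
  by case: (unliftP i0 i) => [i'|] ->; rewrite ?ord1.
- move=> v; have [a [b [c [p [q ->]]]]] := gen v.
  have [A [A01 A10 A00]] := sl2_of_entries a b c.
  exists (A, \col_i (if i == i0 then p else q)).
  by rewrite /F /of_sl2 /theta /= A01 A10 A00 !mxE.
move=> [A x] [B y]; rewrite /F /= of_sl2_lie // (lieDl (of_sl2 _ _ _ A))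
    !(lieDr (of_sl2 _ _ _ B)) act ab addr0.
rewrite (lieC (theta x) (of_sl2 _ _ _ _)) act /sl_std_act -addrA; congr (_ + _).
have -> : theta (val A *m y - val B *m x) = theta (val A *m y) - theta (val B *m x).
  by rewrite [X in theta X]addrC -[X in theta (X + _)]scaleN1r theta_lin scaleN1r [LHS]addrC.
by [].
Qed.

End Semidirect.

Section UpperTriangular.
Variables (g : lieAlgType K) (p q n a b : g).
Hypothesis K3 : 3%:R != 0 :> K.
Hypotheses (pq : [lie p, q] = 0) (pn : [lie p, n] = n) (qn : [lie q, n] = - n)
  (pa : [lie p, a] = a) (pb : [lie p, b] = 0) (qa : [lie q, a] = 0) (qb : [lie q, b] = b)
  (na : [lie n, a] = 0) (nb : [lie n, b] = a) (ab : [lie a, b] = 0).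
Hypothesis gen : forall v, exists x y z s t, v = comb3 p q n x y z + comb2 a b s t.
Hypothesis indep : forall x y z s t, comb3 p q n x y z + comb2 a b s t = 0 ->
  [/\ x = 0, y = 0, z = 0, s = 0 & t = 0].

Local Notation ut := (upper_sl K 3).

Lemma upper_sl_trace (M : ut) : val (val M) i2 i2 = - (val (val M) i0 i0 + val (val M) i1 i1).
Proof.
apply/eqP; rewrite -addr_eq0 addrC.
have := valP (val M); rewrite inE => /eqP <-.
by rewrite /mxtrace !big_ord_recl big_ord0 addr0 addrA.
Qed.

Lemma upper_sl0 (M : ut) (i j : 'I_3) : (j < i)%N -> val (val M) i j = 0.
Proof. by move: i j; apply/upper_trigP; apply: (valP M). Qed.

(** In matrix units indexed from 0, [n], [a], [b] stand for E01, E02, E12, while [p] and [q] stand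
    for E00 and E11 minus one third of the identity. This explains the differences with the last
    diagonal entry. *)
Lemma lie_isog_upper_sl : lie_isog g ut.
Proof.
pose E (M : ut) i j := val (val M) i j.
pose F (M : ut) : g := comb3 p q n (E M i0 i0 - E M i2 i2) (E M i1 i1 - E M i2 i2) (E M i0 i1) +
  comb2 a b (E M i0 i2) (E M i1 i2).
have F_lin : linear F.
  move=> k M N; rewrite /F [in RHS]scalerDr comb3Z comb2Z [RHS]addrACA comb3D comb2D /E
      !linearP /= !mxE.
  by congr (comb3 _ _ _ _ _ _ + _); ring.
pose FM := GRing.isLinear.Build _ _ _ _ F F_lin.
pose FL : {linear ut -> g} := HB.pack F FM.
apply: (@lie_isog_inv _ _ _ FL) => /=.
- move=> M N /eqP; rewrite -subr_eq0 -(linearB FL).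
  move=> /eqP/indep[]; rewrite /E; set P := M - N => x0 y0 z0 s0 t0.
  apply/eqP; rewrite -subr_eq0 -/P; apply/eqP/val_inj/val_inj.
  have d0 : val (val P) i2 i2 = 0.
    apply: (mulfI K3); rewrite mulr0; have := upper_sl_trace P.
    move/eqP: x0; rewrite subr_eq0 => /eqP->; move/eqP: y0; rewrite subr_eq0 => /eqP-> H.
    have -> : 3 * val (val P) i2 i2 = val (val P) i2 i2 - - (val (val P) i2 i2 + val (val P)
        i2 i2) by ring.
    by rewrite -H subrr.
  move: x0 y0; rewrite d0 !subr0 => x0 y0.
  apply/matrixP => i j; rewrite [RHS]mxE.
  case: (unliftP i0 i) => [i'|] ->; case: (unliftP i0 j) => [j'|] -> //.
  + case: (unliftP i0 i') => [i''|] ->; case: (unliftP i0 j') => [j''|] -> //; rewrite ?ord1 //.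
    exact: upper_sl0.
  + exact: upper_sl0.
  + by case: (unliftP i0 j') => [j''|] ->; rewrite ?ord1.
- move=> v; have [x [y [z [s [t ->]]]]] := gen v.
  (* The scalar shift that makes diag(x, y, 0) traceless. *)
  pose d := - (x + y) / 3%:R.
  pose M : 'M[K]_3 := \matrix_(i, j)
    if i == i0 then (if j == i0 then x + d else if j == i1 then z else s)
    else if i == i1 then (if j == i0 then 0 else if j == i1 then y + d else t)
    else (if j == i2 then d else 0).
  have trM : M \in lieSubalg_pred (LieSubalg (@traceless_submod K 3) (@traceless_lie K 3)).
    rewrite inE /mxtrace !big_ord_recl big_ord0 !mxE /= /d; apply/eqP; field.
    exact: K3.
  have utM : (LieSub trM : sl K 3) \in lieSubalg_pred (LieSubalg (@upper_trig_submod K 3)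
      (@upper_trig_lie K 3)).
    apply/upper_trigP => i j; rewrite /= mxE.
    by case: (unliftP i0 i) => [i'|] ->; case: (unliftP i0 j) => [j'|] -> //;
      case: (unliftP i0 i') => [i''|] ->; rewrite ?ord1 //;
          case: (unliftP i0 j') => [j''|] ->; rewrite ?ord1.
  exists (LieSub utM); rewrite /F /E /= !mxE /=.
  by congr (comb3 _ _ _ _ _ _ + _); ring.
have E3 x y z x' y' z' : [lie comb3 p q n x y z, comb3 p q n x' y' z'] =
    comb3 p q n 0 0 (x * z' - z * x' - y * z' + z * y').
  have E_pq : [lie p, q] = comb3 p q n 0 0 0 by rewrite comb30.
  have E_pn : [lie p, n] = comb3 p q n 0 0 1 by rewrite /comb3 comb20 scale1r add0r.
  have E_qn : [lie q, n] = comb3 p q n 0 0 (- 1) by rewrite /comb3 comb20 scaleN1r add0r.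
  rewrite [in LHS]/comb3 ![in LHS]/comb2 !lieDl !lieDr !lieZl !lieZr !liexx.
  rewrite (lieC q p) (lieC n p) (lieC n q) -(comb30 p q n) E_pq E_pn E_qn.
  rewrite -!(scaleN1r (comb3 _ _ _ _ _ _)) !comb3Z !comb3D.
  by congr comb3; ring.
have E32 x y z s t : [lie comb3 p q n x y z, comb2 a b s t] = comb2 a b (x * s + z * t) (y * t).
  have E_pa : [lie p, a] = comb2 a b 1 0 by rewrite /comb2 scale1r scale0r addr0.
  have E_pb : [lie p, b] = comb2 a b 0 0 by rewrite comb20.
  have E_qa : [lie q, a] = comb2 a b 0 0 by rewrite comb20.
  have E_qb : [lie q, b] = comb2 a b 0 1 by rewrite /comb2 scale1r scale0r add0r.
  have E_na : [lie n, a] = comb2 a b 0 0 by rewrite comb20.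
  have E_nb : [lie n, b] = comb2 a b 1 0 by rewrite /comb2 scale1r scale0r addr0.
  rewrite [in LHS]/comb3 ![in LHS]/comb2 !lieDl !lieDr !lieZl !lieZr.
  rewrite E_pa E_pb E_qa E_qb E_na E_nb !comb2Z !comb2D.
  by congr comb2; ring.
have E22 s t s' t' : [lie comb2 a b s t, comb2 a b s' t'] = 0.
  rewrite /comb2 !lieDl !lieDr !lieZl !lieZr (lieC b) ab !liexx oppr0.
  by rewrite !scaler0 !addr0.
move=> M N; rewrite /F.
rewrite (lieDl (comb3 _ _ _ _ _ _)) !(lieDr (comb3 _ _ _ _ _ _)) E3 E32 E22 addr0.
rewrite (lieC (comb2 _ _ _ _) (comb3 _ _ _ _ _ _)) E32 comb2N -[RHS]addrA comb2D /E /= !mxE.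
rewrite !big_ord_recl !big_ord0.
have lo (X : ut) : [/\ val (val X) i1 i0 = 0, val (val X) i2 i0 = 0 & val (val X) i2 i1 = 0].
  by split; apply: upper_sl0.
have [M10 M20 M21] := lo M; have [N10 N20 N21] := lo N.
rewrite /= in M10 M20 M21 N10 N20 N21; rewrite M10 M20 M21 N10 N20 N21.
by congr (comb3 _ _ _ _ _ _ + comb2 _ _ _ _); ring.
Qed.

End UpperTriangular.

End ConcreteAlgebras.

Section SubLieAlgebra.
Variables (K : fieldType) (g : finLieAlgType K) (U : {vspace g}).
Hypothesis lieU : {in U &, forall x y, [lie x, y] \in U}.
Implicit Types x y z : subvs_of U.

Definition subvs_lie x y : subvs_of U := Subvs (lieU (subvsP x) (subvsP y)).

Fact subvs_lie_linearl y : linear (subvs_lie^~ y).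
Proof. by move=> a x z; apply: val_inj; rewrite /= lie_linearl. Qed.

Fact subvs_lie_linearr x : linear (subvs_lie x).
Proof. by move=> a y z; apply: val_inj; rewrite /= lie_linearr. Qed.

Fact subvs_liexx x : subvs_lie x x = 0.
Proof. by apply: val_inj; rewrite /= liexx. Qed.

Fact subvs_lie_jacobi x y z :
  subvs_lie x (subvs_lie y z) + subvs_lie y (subvs_lie z x) + subvs_lie z (subvs_lie x y) = 0.
Proof. by apply: val_inj; rewrite /= lie_jacobi. Qed.

Definition subvs_finLieAlg : finLieAlgType K :=
  HB.pack (subvs_of U) (isLieAlgebra.Build K (subvs_of U)
    subvs_lie_linearl subvs_lie_linearr subvs_liexx subvs_lie_jacobi).

End SubLieAlgebra.

Lemma dim2_basis (K : fieldType) (V : vectType K) (U : {vspace V}) : \dim U = 2%N ->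
  exists u w, [/\ u \in U, w \in U, forall v, v \in U -> exists a b, v = comb2 u w a b
    & forall a b, comb2 u w a b = 0 -> a = 0 /\ b = 0].
Proof.
move=> dimU; have szX : size (vbasis U) = 2%N by rewrite size_tuple dimU.
move: szX (vbasisP U).
case: (tval _) => [|u [|w []]] // _ basU; exists u, w; split.
- by rewrite (basis_mem basU) ?mem_head.
- by rewrite (basis_mem basU) ?inE ?eqxx ?orbT.
- move=> v; rewrite -(span_basis basU) span_cons span_seq1.
  case/memv_addP => _ /vlineP[a ->] [_ /vlineP[b ->] ->]; exists a, b => //.
move=> a b ab0; have /freeP fr := basis_free basU : free [tuple u; w].
have := fr (fun i => if i == ord0 then a else b).
rewrite !big_ord_recl big_ord0 /= addr0 => /(_ ab0) k0.
by split; [have := k0 ord0 | have := k0 (lift ord0 ord0)].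
Qed.

(** * Splitting off a copy of sl(2) with its centralizer *)

Section Sl2Complement.
Variables (K : numClosedFieldType) (g : finLieAlgType K).
Hypothesis dimg : \dim {:g} = 5%N.
Variables e f h : g.
Hypotheses (efh : sl2_triple e f h) (e0 : e != 0).
Hypothesis gen : forall v, exists z r s a b,
  [/\ v = z + r *: e + s *: f, [lie z, e] = a *: e & [lie z, f] = b *: f].

Let C := (lker (ad e) :&: lker (ad f))%VS.

(** An element [z] scaling [e] and [f] by [a] and [b] scales [h] by a + b; applying it to [h, e] = 2
    e forces b = - a. Then z - (a / 2) h centralizes the triple, and the centralizer is a complement
    of dimension 2. *)
Lemma sl2_complement :
  lie_isog g (sl K 2 * abelian_lie 'cV[K]_2)%type \/
  exists r2 : finLieAlgType K,
    [/\ \dim {:r2} = 2%N, ~ lie_abelian r2 & lie_isog g (sl K 2 * r2)%type].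
Proof.
have [he hf ef] := efh.
have two0 : 2 != 0 :> K by rewrite pnatr_eq0.
have h0 : h != 0.
  apply: contraNneq e0 => h0; move: he; rewrite h0 lie0l => /esym/eqP.
  by rewrite scaler_eq0 (negPf two0).
have CE y : (y \in C) = ([lie e, y] == 0) && ([lie f, y] == 0).
  by rewrite memv_cap !memv_ker !adE.
have CP y : y \in C -> [/\ [lie e, y] = 0, [lie f, y] = 0 & [lie h, y] = 0].
  rewrite CE => /andP[/eqP ey /eqP fy]; split => //.
  by rewrite -ef lie_lieE ey fy !lie0r subrr.
have genC v : exists a b c y, y \in C /\ v = comb3 e f h a b c + y.
  have [z [r [s [a [b [-> ze zf]]]]]] := gen v.
  have zh : [lie z, h] = (a + b) *: h.
    by rewrite -ef lie_der ze zf lieZl lieZr -scalerDl.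
  have ab : a + b = 0.
    have := lie_der z h e; rewrite he zh ze !lieZr lieZl ze he => /esym/eqP.
    rewrite !scalerA [2 * a]mulrC -subr_eq0 addrK scaler_eq0 (negPf e0) orbF.
    by rewrite mulf_eq0 (negPf two0) orbF => /eqP.
  exists r, s, (a / 2), (z - (a / 2) *: h); split.
    rewrite CE; apply/andP; split; rewrite lieC oppr_eq0 lieDl lieNl lieZl ?ze ?zf ?he ?hf
        scalerA.
      by rewrite divfK // subrr.
    by rewrite mulrN divfK // scaleNr opprK -scalerDl addrC ab scale0r.
  by rewrite /comb3 /comb2 [RHS]addrACA subrr addr0 -addrA [LHS]addrC.
have indC a b c y : y \in C -> comb3 e f h a b c + y = 0 -> [/\ a = 0, b = 0, c = 0 & y = 0].
  move=> /CP[ey fy hy] E.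
  (* [ad e] applied to the relation; [ad h] then kills the left side but not [e], giving c = 0. *)
  have E1 : b *: h = (2 * c) *: e.
    have := congr1 (lie e) E; rewrite lie0r /comb3 /comb2 !lieDr !lieZr liexx ey ef.
    rewrite (lieC e h) he scalerN scaler0 add0r addr0 scalerA [c * 2]mulrC => /eqP.
    by rewrite subr_eq0 => /eqP.
  have c0 : c = 0.
    have := congr1 (lie h) E1; rewrite !lieZr liexx he scaler0 scalerA => /esym/eqP.
    by rewrite scaler_eq0 (negPf e0) orbF !mulf_eq0 (negPf two0) orbF => /eqP.
  have b0 : b = 0.
    by move/eqP: E1; rewrite c0 mulr0 scale0r scaler_eq0 (negPf h0) orbF => /eqP.
  have a0 : a = 0.
    have := congr1 (lie f) E; rewrite b0 c0 lie0r /comb3 /comb2 !scale0r !addr0 lieDr lieZr fy.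
    by rewrite addr0 lieC ef scalerN => /eqP;
        rewrite oppr_eq0 scaler_eq0 (negPf h0) orbF => /eqP.
  by split=> //; move: E; rewrite a0 b0 c0 comb30 add0r.
have lieCC : {in C &, forall y z, [lie y, z] \in C}.
  move=> y z /CP[ey fy _] /CP[ez fz _]; rewrite CE (lie_der e y) (lie_der f y) ey fy ez fz.
  by rewrite !lie0l !lie0r !addr0 eqxx.
have dimC : \dim C = 2%N.
  pose S := (<<[:: e; f; h]>>)%VS.
  have SP v : v \in S -> exists a b c, v = comb3 e f h a b c.
    rewrite /S !span_cons span_nil addv0 => /memv_addP[_ /vlineP[a ->]].
    by case=> _ /memv_addP[_ /vlineP[b ->] [_ /vlineP[c ->] ->]] ->; exists a, b, c;
        rewrite addrA.
  have comb3S a b c : comb3 e f h a b c \in S.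
    by rewrite !memvD ?memvZ // memv_span ?inE ?eqxx ?orbT.
  have SC : (S :&: C = 0)%VS.
    apply/eqP; rewrite -subv0; apply/subvP => v /memv_capP[/SP[a [b [c def_v]]] Cv].
    have [||a0 b0 c0 v0] := @indC a b c (- v); [by rewrite memvN | by rewrite -def_v subrr |].
    by rewrite def_v a0 b0 c0 comb30 mem0v.
  have dimS : \dim S = 3%N.
    apply/eqP; suff: free [tuple e; f; h] by rewrite /free.
    apply/freeP => k; rewrite !big_ord_recl big_ord0 addr0 /= addrA => E i.
    have [||a0 b0 c0 _] := @indC (k ord0) (k (lift ord0 ord0))
        (k (lift ord0 (lift ord0 ord0))) 0.
    - exact: mem0v.
    - by rewrite addr0.
    case: (unliftP ord0 i) => [j|] -> //; case: (unliftP ord0 j) => [j'|] -> //.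
    by rewrite ord1.
  have : \dim (S + C) = 5%N.
    rewrite -dimg; congr (\dim _); apply/eqP; rewrite eqEsubv subvf; apply/subvP => v _.
    by have [a [b [c [y [Cy ->]]]]] := genC v; rewrite memv_add.
  by rewrite dimv_disjoint_sum // dimS => -[].
pose r2 := subvs_finLieAlg lieCC.
have [r2ab|r2nab] := pselect (lie_abelian r2); last first.
  right; exists r2; split => //; first by rewrite dimvf.
  pose theta : {linear r2 -> g} := @vsval _ _ C.
  apply: (@lie_isog_sl2_prod _ _ e f h r2 theta) => //.
  - by move=> y; have [ey fy hy] := CP _ (subvsP y).
  - move=> v; have [a [b [c [y [Cy ->]]]]] := genC v.
    by exists a, b, c, (Subvs Cy).
  move=> a b c y /(indC _ _ _ _ (subvsP y))[-> -> -> y0]; split => //.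
  exact: val_inj.
left; have [u [w [Cu Cw uwP uw0]]] := dim2_basis dimC.
pose theta (v : abelian_lie 'cV[K]_2) : g :=
  comb2 u w ((v : 'cV[K]_2) ord0 0) ((v : 'cV[K]_2) (lift ord0 ord0) 0).
have theta_lin : linear theta by move=> a v1 v2; rewrite /theta comb2Z comb2D !mxE.
pose thetaM := GRing.isLinear.Build _ _ _ _ theta theta_lin.
pose thetaL : {linear abelian_lie 'cV[K]_2 -> g} := HB.pack theta thetaM.
have thetaC v : theta v \in C by rewrite memvD ?memvZ.
have abC y z : y \in C -> z \in C -> [lie y, z] = 0.
  by move=> Cy Cz; have := congr1 val (r2ab (Subvs Cy) (Subvs Cz)).
apply: (@lie_isog_sl2_prod _ _ e f h _ thetaL) => //.
- by move=> y z; rewrite abC ?thetaC // [LHS](linear0 thetaL).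
- by move=> y; apply: CP; apply: thetaC.
- move=> v; have [a [b [c [y [Cy ->]]]]] := genC v; have [p [q ->]] := uwP y Cy.
  exists a, b, c, (\col_i (if i == ord0 then p else q)).
  by rewrite /= /theta !mxE.
move=> a b c y /(indC _ _ _ _ (thetaC y))[-> -> -> /uw0[y0 y1]]; split => //.
apply/matrixP => i j; rewrite ord1 [RHS]mxE.
by case: (unliftP ord0 i) => [i'|] ->; rewrite ?ord1.
Qed.

End Sl2Complement.

(** * The non-solvable case *)

Section NonsolvableCases.
Variables (K : numClosedFieldType) (g : finLieAlgType K) (x : g).
Local Notation G := (genspace (ad x)).
Implicit Types (a b m : K) (e f u v z : g).

Lemma genspace_line b u : \dim (G b) = 1%N -> u \in G b -> u != 0 -> G b = <[u]>%VS.
Proof.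
by move=> dimG Gu u0; apply/esym/eqP; rewrite eqEdim dim_vline u0 dimG -memvE Gu.
Qed.

Lemma genspace_scale b u v :
  \dim (G b) = 1%N -> u \in G b -> u != 0 -> v \in G b -> exists k, v = k *: u.
Proof. by move=> dimG Gu u0; rewrite (genspace_line dimG Gu u0) => /vlineP. Qed.

Lemma genspace_eigen b u : \dim (G b) = 1%N -> u \in G b -> [lie x, u] = b *: u.
Proof.
move=> dimG Gu; have [->|u0] := eqVneq u 0; first by rewrite lie0r scaler0.
have [|k xu] := genspace_scale dimG Gu u0 (v := [lie x, u]).
  by rewrite -adE genspace_stable.
have [->//|bk] := eqVneq b k.
by rewrite -adE in xu; rewrite (genspace_eq0 Gu xu bk) eqxx in u0.
Qed.

Lemma genspace_nz b : \dim (G b) != 0%N -> exists2 u, u \in G b & u != 0.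
Proof. by rewrite dimv_eq0 => G0; exists (vpick (G b)); rewrite ?memv_pick ?vpick0. Qed.

Lemma genspace0 b u : \dim (G b) = 0%N -> u \in G b -> u = 0.
Proof. by move/eqP; rewrite dimv_eq0 => /eqP -> ; rewrite memv0 => /eqP. Qed.

(** [G 0] has dimension 3 and acts by scalars on the lines [G a] and [G (- a)], as [sl2_complement]
    requires. Since [c] is nonzero, scaling [f] and [[lie e, f]] by 2 / c yields an sl(2)-triple. *)
Lemma weight_zero_case a e f c : \dim {:g} = 5%N -> a != 0 ->
    (forall b, \dim (G b) = count_mem b [:: 0; a; - a; 0; 0]) ->
    e \in G a -> f \in G (- a) -> [lie e, f] != 0 ->
    [lie [lie e, f], e] = c *: e -> c != 0 ->
  lie_isog g (sl K 2 * abelian_lie 'cV[K]_2)%type \/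
  exists r2 : finLieAlgType K,
    [/\ \dim {:r2} = 2%N, ~ lie_abelian r2 & lie_isog g (sl K 2 * r2)%type].
Proof.
move=> dimg a0 dimG Ge Gf ef0 he c0.
have e0 : e != 0 by apply: contraNneq ef0 => ->; rewrite lie0l.
have f0 : f != 0 by apply: contraNneq ef0 => ->; rewrite lie0r.
have ana : - a == a = false.
  by apply/negbTE; rewrite eq_sym -subr_eq0 opprK -mulr2n mulrn_eq0.
have dima : \dim (G a) = 1%N.
  by rewrite dimG /= eqxx ana [0 == a]eq_sym (negPf a0).
have dimna : \dim (G (- a)) = 1%N.
  by rewrite dimG /= eqxx [0 == - a]eq_sym oppr_eq0 [a == - a]eq_sym ana (negPf a0).
have Gh : [lie e, f] \in G 0 by have := genspace_lie Ge Gf; rewrite subrr.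
have actE z : z \in G 0 -> exists k, [lie z, e] = k *: e.
  move=> Gz; apply: (genspace_scale dima) => //.
  by have := genspace_lie Gz Ge; rewrite add0r.
have actF z : z \in G 0 -> exists k, [lie z, f] = k *: f.
  move=> Gz; apply: (genspace_scale dimna) => //.
  by have := genspace_lie Gz Gf; rewrite add0r.
have [d hf] := actF _ Gh.
have dc : d = - c.
  have := lie_der [lie e, f] e f; rewrite liexx he hf lieZl lieZr -scalerDl => /esym/eqP.
  by rewrite scaler_eq0 (negPf ef0) orbF addr_eq0 => /eqP->; rewrite opprK.
have k0 : 2 / c != 0 by rewrite mulf_neq0 ?invr_eq0 ?pnatr_eq0.
apply: (@sl2_complement _ _ dimg e ((2 / c) *: f) ((2 / c) *: [lie e, f])) => //.
  split; rewrite ?lieZl ?lieZr //; first by rewrite he scalerA divfK.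
  by rewrite hf dc !scalerA; congr (_ *: f); field.
pose S := (G 0 + <<[:: e; f]>>)%VS.
have Sfull : S = {:g}%VS.
  apply: (genspace_span (f := ad x)) => b.
  have [->|b0] := eqVneq b 0; first exact: addvSl.
  have [->|ba] := eqVneq b a.
    by rewrite (genspace_line dima Ge e0) (subv_trans _ (addvSr _ _))
        // -memvE memv_span ?mem_head.
  have [->|bna] := eqVneq b (- a).
    by rewrite (genspace_line dimna Gf f0) (subv_trans _ (addvSr _ _))
        // -memvE memv_span ?inE ?eqxx ?orbT.
  have /eqP : \dim (G b) = 0%N.
    by rewrite dimG /= ![_ == b]eq_sym (negPf b0) (negPf ba) (negPf bna).
  by rewrite dimv_eq0 => /eqP ->; apply: sub0v.
move=> v; have : v \in S by rewrite Sfull memvf.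
rewrite /S span_cons span_seq1 =>
    /memv_addP[z Gz [_ /memv_addP[_ /vlineP[r ->] [_ /vlineP[s ->] ->]] ->]].
have [p ze] := actE z Gz; have [q zf] := actF z Gz.
exists z, r, (s / (2 / c)), p, q; split => //; first by rewrite scalerA divfK // addrA.
by rewrite lieZr zf !scalerA mulrC.
Qed.

(* If [G a] is two-dimensional, [e] and [e2] in it commute, and the Jacobi identity
   for [e], [e2], [f] forces them to be proportional. *)
Lemma weight_double_case a e f : a != 0 -> \dim (G 0) = 1%N -> \dim (G a) = 2%N ->
    \dim (G (a + a)) = 0%N -> e \in G a -> f \in G (- a) -> [lie e, f] != 0 -> False.
Proof.
move=> a0 dim0 dima dim2a Ge Gf ef0.
have e0 : e != 0 by apply: contraNneq ef0 => ->; rewrite lie0l.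
have G0 z : z \in G a -> [lie z, f] \in G 0.
  by move=> Gz; have := genspace_lie Gz Gf; rewrite subrr.
have [r xr] := genspace_scale dim0 (G0 e Ge) ef0 (genspace_self x).
have /subvPn[e2 Ge2 e2P] : ~~ (G a <= <[e]>)%VS.
  by apply/negP => /dimvS; rewrite dima dim_vline e0.
have [k e2f] := genspace_scale dim0 (G0 e Ge) ef0 (G0 e2 Ge2).
have ee2 : [lie e, e2] = 0 by apply: genspace0 dim2a _; apply: genspace_lie.
(* Jacobi shows that [[lie e, f]], and so its multiple [x], commutes with e2 - k e; but [x] has no
   eigenvalue 0 on [G a]. *)
have xe : [lie x, e2 - k *: e] = 0.
  have := lie_lieE e e2 f; rewrite ee2 lie0l e2f lieZr => /esym/eqP; rewrite subr_eq0 => /eqP E.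
  rewrite {1}xr lieZl lieDr lieNr lieZr (lieC _ e2) (lieC _ e) -E scalerN opprK addNr.
  by rewrite scaler0.
have Gd : e2 - k *: e \in G a by rewrite memvB ?memvZ.
move: xe; rewrite -adE -[RHS](scale0r (e2 - k *: e)) => xe.
have /eqP := genspace_eq0 Gd xe a0; rewrite subr_eq0 => /eqP e2e.
by rewrite e2e memvZ ?memv_line in e2P.
Qed.

(** * Five pairwise distinct weights: every weight space is a line *)

Section Distinct.
Variables (a m : K) (e f u v : g).
Hypotheses (a0 : a != 0) (m0 : m != 0) (ma : m != a) (mna : m != - a).
Hypothesis dimG : forall b, \dim (G b) = count_mem b [:: 0; a; - a; m; - m].
Hypotheses (Ge : e \in G a) (Gf : f \in G (- a)) (ef0 : [lie e, f] != 0).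
Hypotheses (Gu : u \in G m) (u0 : u != 0) (Gv : v \in G (- m)) (v0 : v != 0).

Let nz2 b : b != 0 -> (b == - b) = false.
Proof. by move=> b0; apply/negbTE; rewrite -subr_eq0 opprK -mulr2n mulrn_eq0. Qed.

Let dim1 b : b \in [:: 0; a; - a; m; - m] -> \dim (G b) = 1%N.
Proof.
have am : a != - m by rewrite eq_sym eqr_oppLR.
move=> b_in; rewrite dimG count_uniq_mem ?b_in //= !inE !negb_or ![0 == _]eq_sym !oppr_eq0.
by rewrite a0 m0 (nz2 a0) (nz2 m0) eqr_opp eqr_oppLR am [a == m]eq_sym ma.
Qed.

Let dim0 b : b \notin [:: 0; a; - a; m; - m] -> \dim (G b) = 0%N.
Proof. by move=> b_in; rewrite dimG; apply/count_memPn. Qed.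

Let Gh : [lie e, f] \in G 0.
Proof. by have := genspace_lie Ge Gf; rewrite subrr. Qed.

Let x_scale : exists2 r, r != 0 & [lie e, f] = r *: x.
Proof.
have x0 : x != 0.
  apply: contraNneq u0 => x0; have := genspace_eigen (dim1 _) Gu.
  rewrite !inE eqxx !orbT => /(_ isT); rewrite x0 lie0l => /esym/eqP.
  by rewrite scaler_eq0 (negPf m0).
have [|r efr] := genspace_scale (dim1 _) (genspace_self x) x0 Gh.
  by rewrite inE eqxx.
by exists r => //; apply: contraNneq ef0 => r0; rewrite efr r0 scale0r.
Qed.

(** Otherwise [e] and [f] both kill [u], hence so does [[lie e, f]], a nonzero multiple of [x],
    although [x] acts on [u] by [m]. *)
Lemma weight_relation : (a + m) \in [:: 0; a; - a; m; - m] \/ (m - a) \in [:: 0; a; - a; m;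
    - m].
Proof.
have [|/dim0 dimp] := boolP ((a + m) \in [:: 0; a; - a; m; - m]); first by left.
have [|/dim0 dimm] := boolP ((m - a) \in [:: 0; a; - a; m; - m]); first by right.
have [r r0 efr] := x_scale.
have eu : [lie e, u] = 0 by apply: genspace0 dimp _; apply: genspace_lie.
have fu : [lie f, u] = 0 by apply: genspace0 dimm _; rewrite addrC; apply: genspace_lie.
have := lie_lieE e f u; rewrite eu fu !lie0r subrr efr lieZl (genspace_eigen _ Gu).
  by move=> /eqP; rewrite !scaler_eq0 (negPf r0) (negPf m0) (negPf u0).
by apply: dim1; rewrite !inE eqxx !orbT.
Qed.

(** Of the ten coincidences allowed by [weight_relation], six contradict the distinctness of the
    weights. *)
Lemma weight_ratio : [\/ m = 2 * a, m = - (2 * a), a = 2 * m | a = - (2 * m)].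
Proof.
case: weight_relation; rewrite !inE => /orP[|/orP[|/orP[|/orP[|]]]].
- by rewrite addrC addr_eq0 (negPf mna).
- by rewrite -subr_eq0 addrAC subrr add0r (negPf m0).
- by rewrite addrC => /eqP/(canRL (addrK _)) ->; constructor 2; ring.
- by rewrite -subr_eq0 addrK (negPf a0).
- by move=> /eqP/(canRL (addrK _)) ->; constructor 4; ring.
- by rewrite subr_eq0 (negPf ma).
- by move=> /eqP/(canRL (subrK _)) ->; constructor 1; ring.
- by rewrite -subr_eq0 opprK subrK (negPf m0).
- by rewrite -subr_eq0 addrAC subrr add0r oppr_eq0 (negPf a0).
- by move=> /eqP/(canRL (subrK _)) => E; constructor 3; rewrite mulr_natl mulr2n {1}E; ring.
Qed.

(** If m = 2 a, then 3 a is not a weight, so [e] kills [u]; and [[lie f, u]] is in [G a], a multiple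
    of [e], so [e] kills it too. Again [[lie e, f]] would kill [u]. *)
Lemma weight_ratio_nz : m != 2 * a.
Proof.
apply/eqP => m2a; have [r r0 efr] := x_scale.
have nza n : (n.+1)%:R * a != 0 by rewrite mulf_neq0 ?pnatr_eq0.
have dim3a : \dim (G (a + m)) = 0%N.
  apply: dim0; rewrite m2a !inE !negb_or; apply/and5P; split.
  - by rewrite (_ : _ + _ = 3 * a); [exact: (nza 2%N) | ring].
  - by rewrite -subr_eq0 (_ : _ - _ = 2 * a); [exact: (nza 1%N) | ring].
  - by rewrite -subr_eq0 (_ : _ - _ = 4 * a); [exact: (nza 3%N) | ring].
  - by rewrite -subr_eq0 (_ : _ - _ = 1 * a); [exact: (nza 0%N) | ring].
  - by rewrite -subr_eq0 (_ : _ - _ = 5 * a); [exact: (nza 4%N) | ring].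
have eu : [lie e, u] = 0 by apply: genspace0 dim3a _; apply: genspace_lie.
have [|||k fu] := @genspace_scale a e [lie f, u] _ Ge.
- by apply: dim1; rewrite !inE eqxx !orbT.
- by apply: contraNneq ef0 => ->; rewrite lie0l.
- by have := genspace_lie Gf Gu; rewrite m2a (_ : - a + 2 * a = a) //; ring.
have := lie_lieE e f u; rewrite eu fu lieZr liexx scaler0 lie0r subrr efr lieZl
    (genspace_eigen _ Gu).
  by move=> /eqP; rewrite !scaler_eq0 (negPf r0) (negPf m0) (negPf u0).
by apply: dim1; rewrite !inE eqxx !orbT.
Qed.

Lemma weight_half_case : a = 2 * m -> lie_isog g (semidirect (sl_std K 2)).
Proof.
move=> a2m; have [r r0 efr] := x_scale.
have nzm n : (n.+1)%:R * m != 0 by rewrite mulf_neq0 ?pnatr_eq0.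
have e0 : e != 0 by apply: contraNneq ef0 => ->; rewrite lie0l.
have f0 : f != 0 by apply: contraNneq ef0 => ->; rewrite lie0r.
have x0 : x != 0 by apply: contraNneq ef0 => x0; rewrite efr x0 scaler0.
have [d0 da dna dm dnm] : [/\ \dim (G 0) = 1%N, \dim (G a) = 1%N, \dim (G (- a)) = 1%N,
    \dim (G m) = 1%N & \dim (G (- m)) = 1%N].
  by split; apply: dim1; rewrite !inE eqxx ?orbT.
have xe := genspace_eigen da Ge; have xf := genspace_eigen dna Gf.
have xu := genspace_eigen dm Gu; have xv := genspace_eigen dnm Gv.
have dim3m : \dim (G (a + m)) = 0%N.
  apply: dim0; rewrite a2m !inE !negb_or; apply/and5P; split.
  - by rewrite (_ : _ + _ = 3 * m); [exact: (nzm 2%N) | ring].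
  - by rewrite -subr_eq0 (_ : _ - _ = 1 * m); [exact: (nzm 0%N) | ring].
  - by rewrite -subr_eq0 (_ : _ - _ = 5 * m); [exact: (nzm 4%N) | ring].
  - by rewrite -subr_eq0 (_ : _ - _ = 2 * m); [exact: (nzm 1%N) | ring].
  - by rewrite -subr_eq0 (_ : _ - _ = 4 * m); [exact: (nzm 3%N) | ring].
have dimn3m : \dim (G (- a - m)) = 0%N.
  apply: dim0; rewrite a2m !inE !negb_or; apply/and5P; split.
  - by rewrite -oppr_eq0 (_ : - (- (2 * m) - m) = 3 * m); [exact: (nzm 2%N) | ring].
  - by rewrite eq_sym -subr_eq0 (_ : 2 * m - (- (2 * m) - m) = 5 * m);
      [exact: (nzm 4%N) | ring].
  - by rewrite eq_sym -subr_eq0 (_ : - (2 * m) - (- (2 * m) - m) = 1 * m);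
      [exact: (nzm 0%N) | ring].
  - by rewrite eq_sym -subr_eq0 (_ : m - (- (2 * m) - m) = 4 * m); [exact: (nzm 3%N) | ring].
  - by rewrite eq_sym -subr_eq0 (_ : - m - (- (2 * m) - m) = 2 * m); [exact: (nzm 1%N) | ring].
have eu : [lie e, u] = 0 by apply: genspace0 dim3m _; apply: genspace_lie.
have fv : [lie f, v] = 0 by apply: genspace0 dimn3m _; apply: genspace_lie.
have [|k fu] := @genspace_scale (- m) v [lie f, u] dnm Gv v0.
  by have := genspace_lie Gf Gu; rewrite a2m (_ : - (2 * m) + m = - m) //; ring.
have [|l ev] := @genspace_scale m u [lie e, v] dm Gu u0.
  by have := genspace_lie Ge Gv; rewrite a2m (_ : 2 * m - m = m) //; ring.
have kl : k * l = r * m.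
  have := lie_lieE e f u; rewrite eu fu lie0r subr0 lieZr ev efr lieZl xu !scalerA => /eqP.
  rewrite -subr_eq0 -scalerBl scaler_eq0 (negPf u0) orbF subr_eq0 => /eqP ->.
  by [].
have /andP[k0 l0] : (k != 0) && (l != 0).
  by rewrite -negb_or -mulf_eq0 kl mulf_neq0.
have [|s uv] := @genspace_scale 0 x [lie u, v] d0 (genspace_self x) x0.
  by have := genspace_lie Gu Gv; rewrite subrr.
(* The Jacobi identity for [u], [v], [e] gives [[lie [lie u, v], e]] = 0, whereas [x] acts on [e] by
   [a]. *)
have s0 : s = 0.
  have := lie_lieE u v e; rewrite (lieC u e) eu oppr0 lie0r subr0 (lieC v e)
      ev lieNr lieZr liexx.
  rewrite scaler0 oppr0 uv lieZl xe => /eqP.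
  by rewrite !scaler_eq0 (negPf e0) (negPf a0) !orbF => /eqP.
have two0 : 2 != 0 :> K by rewrite pnatr_eq0.
(* [H] is scaled to weight 1 on [u], [F] so that [e, F] = H, and [V] so that [e, V] = u. The last
   condition, [F, u] = V, is then the relation [kl]. *)
pose F := (m * r)^-1 *: f; pose H := m^-1 *: x; pose V := l^-1 *: v.
have mr0 : m * r != 0 by rewrite mulf_neq0.
have GF : F \in G (- a) by rewrite memvZ.
have GH : H \in G 0 by rewrite memvZ ?genspace_self.
have GV : V \in G (- m) by rewrite memvZ.
have [F0 H0 V0] : [/\ F != 0, H != 0 & V != 0].
  by rewrite !scaler_eq0 !negb_or !invr_eq0 mr0 f0 m0 x0 l0 v0.
apply: (@lie_isog_sl2_std _ _ e F H u V).
- split; rewrite /F /H ?lieZl ?lieZr.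
  + by rewrite xe scalerA a2m; congr (_ *: _); field.
  + by rewrite xf !scalerA a2m; congr (_ *: _); field; rewrite m0 r0.
  + by rewrite efr scalerA; congr (_ *: _); field; rewrite m0 r0.
- exact: eu.
- by rewrite /V lieZr ev scalerA mulVf // scale1r.
- rewrite /F /V lieZl fu scalerA; congr (_ *: _).
  by apply: (mulIf l0); rewrite mulVf // -mulrA kl [r * m]mulrC mulVf.
- by rewrite /F /V lieZl lieZr fv !scaler0.
- by rewrite /H lieZl xu scalerA mulVf // scale1r.
- by rewrite /H /V lieZl lieZr xv !scalerA -scaleNr; congr (_ *: _); field; rewrite l0 m0.
- by rewrite /V lieZr uv s0 scale0r scaler0.
- pose S := <<[:: e; F; H; u; V]>>%VS.
  have SG b w : w \in [:: e; F; H; u;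
      V] -> \dim (G b) = 1%N -> w \in G b -> w != 0 -> (G b <= S)%VS.
    by move=> w_in dimb Gw w0; rewrite (genspace_line dimb Gw w0) -memvE memv_span.
  have Sfull : S = {:g}%VS.
    apply: (genspace_span (f := ad x)) => b.
    have [|/dim0/eqP] := boolP (b \in [:: 0; a; - a; m; - m]); last first.
      by rewrite dimv_eq0 => /eqP->; apply: sub0v.
    rewrite !inE => /orP[|/orP[|/orP[|/orP[|]]]] /eqP->.
    + by apply: (SG _ H); rewrite ?inE ?eqxx ?orbT.
    + by apply: (SG _ e); rewrite ?inE ?eqxx ?orbT.
    + by apply: (SG _ F); rewrite ?inE ?eqxx ?orbT.
    + by apply: (SG _ u); rewrite ?inE ?eqxx ?orbT.
    + by apply: (SG _ V); rewrite ?inE ?eqxx ?orbT.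
  move=> w; have : w \in S by rewrite Sfull memvf.
  rewrite /S !span_cons span_nil addv0 => /memv_addP[_ /vlineP[a' ->] [w1 Sw1 ->]].
  case/memv_addP: Sw1 => _ /vlineP[b' ->] [w2 Sw2 ->].
  case/memv_addP: Sw2 => _ /vlineP[c' ->] [w3 Sw3 ->].
  case/memv_addP: Sw3 => _ /vlineP[p' ->] [_ /vlineP[q' ->] ->].
  by exists a', b', c', p', q'; rewrite /comb3 /comb2 !addrA.
move=> a' b' c' p' q' E.
(* The five vectors have distinct weights, so each [genproj] isolates one coefficient. *)
have proj b : comb3 (genproj (ad x) b e) (genproj (ad x) b F) (genproj (ad x) b H) a' b' c' +
    comb2 (genproj (ad x) b u) (genproj (ad x) b V) p' q' = 0.
  by rewrite -linear_comb3 -linear_comb2 -linearD E linear0.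
have coef k' (w : g) : k' *: w = 0 -> w != 0 -> k' = 0.
  by move=> kw w0; apply/eqP; move/eqP: kw; rewrite scaler_eq0 (negPf w0) orbF.
have am : a != - m by rewrite eq_sym eqr_oppLR.
have am' : a != m by rewrite eq_sym.
have [o1 o2] : 0 != a /\ 0 != m by split; rewrite eq_sym.
have neqs := (oppr_eq0, a0, m0, o1, o2, ma, mna, am, am', nz2 a0, nz2 m0, eqr_opp, eqr_oppLR).
have [o3 o4] : 0 != - a /\ 0 != - m by split; rewrite eq_sym oppr_eq0.
have Ge' := genproj_neq Ge; have GF' := genproj_neq GF; have GH' := genproj_neq GH.
have Gu' := genproj_neq Gu; have GV' := genproj_neq GV.
split.
- by have := proj a; rewrite /comb3 /comb2 (genproj_id Ge)
    GF' ?GH' ?Gu' ?GV' ?neqs // !scaler0 !addr0 => /coef; apply.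
- have := proj (- a); rewrite /comb3 /comb2 (genproj_id GF) Ge' ?GH' ?Gu' ?GV' ?neqs //.
  by rewrite !scaler0 !addr0 add0r => /coef; apply.
- have := proj 0; rewrite /comb3 /comb2 (genproj_id GH) Ge' ?GF' ?Gu' ?GV' ?neqs //.
  by rewrite !scaler0 !addr0 add0r => /coef; apply.
- have := proj m; rewrite /comb3 /comb2 (genproj_id Gu) Ge' ?GF' ?GH' ?GV' ?neqs //.
  by rewrite !scaler0 !addr0 add0r => /coef; apply.
- have := proj (- m); rewrite /comb3 /comb2 (genproj_id GV) Ge' ?GF' ?GH' ?Gu' ?neqs //.
  by rewrite !scaler0 !addr0 !add0r => /coef; apply.
Qed.

End Distinct.
End NonsolvableCases.

Theorem nonsolvable_dim5 (K : numClosedFieldType) (g : finLieAlgType K) :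
    \dim {:g} = 5%N -> ~ lie_solvable {:g} ->
  [\/ lie_isog g (sl K 2 * abelian_lie 'cV[K]_2)%type,
      lie_isog g (semidirect (sl_std K 2))
    | exists r2 : finLieAlgType K,
        [/\ \dim {:r2} = 2%N, ~ lie_abelian r2 & lie_isog g (sl K 2 * r2)%type]].
Proof.
move=> dimg /nonsolvable_ad[x [l [Dx l0 Gl]]].
have [a [e [f [a0 Ge Gf phi0]]]] := root_pair Dx l0 Gl.
have ef0 : [lie e, f] != 0.
  by apply: contraNneq phi0 => ->; rewrite linear0 comp_lfun0l linear0.
have [m dimG] := root_dims dimg Dx a0 Ge Gf ef0.
have ana : (a == - a) = false.
  by apply/negbTE; rewrite -subr_eq0 opprK -mulr2n mulrn_eq0.
have double m' : (m' == a) || (m' == - a) -> m = m' -> False.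
  move=> m'a mm'; have count_m b : \dim (genspace (ad x) b) = count_mem b [:: 0; a; - a; a;
      - a].
    by rewrite dimG mm' /=; case/orP: m'a => /eqP->; rewrite ?opprK //=;
      case: (0 == b); case: (a == b); case: (- a == b).
  have nza n : (n.+1)%:R * a != 0 by rewrite mulf_neq0 ?pnatr_eq0.
  apply: (@weight_double_case _ _ x a e f) => //; rewrite count_m /=.
  - by rewrite eqxx !oppr_eq0 (negPf a0).
  - by rewrite [0 == a]eq_sym [- a == a]eq_sym eqxx (negPf a0) ana.
  have a2 : 0 == a + a = false by rewrite eq_sym -mulr2n mulrn_eq0 (negPf a0).
  have a1 : a == a + a = false by rewrite -subr_eq0 opprD addNKr oppr_eq0 (negPf a0).
  have a3 : - a == a + a = false.
    rewrite eq_sym -subr_eq0 opprK (_ : _ + _ = 3 * a); last by ring.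
    by rewrite (negPf (nza 2%N)).
  by rewrite a1 a2 a3.
have [m0|m0] := eqVneq m 0.
  rewrite m0 oppr0 in dimG.
  have dima : \dim (genspace (ad x) a) = 1%N.
    by rewrite dimG /= eqxx [0 == a]eq_sym [- a == a]eq_sym ana (negPf a0).
  have dimna : \dim (genspace (ad x) (- a)) = 1%N.
    by rewrite dimG /= eqxx [0 == - a]eq_sym oppr_eq0 ana (negPf a0).
  have Gh : [lie e, f] \in genspace (ad x) 0 by have := genspace_lie Ge Gf; rewrite subrr.
  have e0 : e != 0 by apply: contraNneq ef0 => ->; rewrite lie0l.
  have f0 : f != 0 by apply: contraNneq ef0 => ->; rewrite lie0r.
  (* [phi0] concerns the weight [l], which may differ from [a]. On the line [G l] a nonzero trace
     means that [[lie e, f]] acts by a nonzero scalar. *)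
  have act b u : \dim (genspace (ad x) b) = 1%N -> u \in genspace (ad x) b -> u != 0 -> l = b ->
      exists2 c, [lie [lie e, f], u] = c *: u & c != 0.
    move=> dimb Gu u0 lb; have [|c hu] := genspace_scale dimb Gu u0 (v := [lie [lie e, f], u]).
      by have := genspace_lie Gh Gu; rewrite add0r.
    exists c => //; apply: contraNneq phi0 => c0; rewrite (_ : (_ \o _)%VF = 0) ?linear0 //.
    apply/lfunP => v; rewrite comp_lfunE adE zero_lfunE.
    have [|k ->] := genspace_scale dimb Gu u0 (v := genproj (ad x) l v).
      by rewrite lb memv_genproj.
    by rewrite lieZr hu c0 scale0r scaler0.
  suff : lie_isog g (sl K 2 * abelian_lie 'cV[K]_2)%type \/
      exists r2 : finLieAlgType K,
        [/\ \dim {:r2} = 2%N, ~ lie_abelian r2 & lie_isog g (sl K 2 * r2)%type].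
    by case; [constructor 1 | constructor 3].
  have [la|lna] := eqVneq l a.
    have [c he c0] := act a e dima Ge e0 la.
    exact: (weight_zero_case dimg a0 dimG Ge Gf ef0 he c0).
  (* The only remaining nonzero weight; the roles of [e] and [f] are then exchanged. *)
  have {}lna : l = - a.
    move: Gl; rewrite -dimv_eq0 dimG -lt0n -has_count has_pred1 !inE (negPf l0) (negPf lna).
    by rewrite /= ?orbF => /eqP.
  have [c hf c0] := act (- a) f dimna Gf f0 lna.
  apply: (@weight_zero_case _ _ x (- a) f e (- c)) => //; rewrite ?oppr_eq0 ?opprK //.
  - by move=> b; rewrite dimG ?opprK ?oppr0 /=; case: (0 == b); case: (a == b);
      case: (- a == b).
  - by rewrite lieC oppr_eq0.
  - by rewrite (lieC f) lieNl hf scaleNr.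
have [ma|ma] := eqVneq m a; first by case: (double m); rewrite ?ma ?eqxx.
have [mna|mna] := eqVneq m (- a); first by case: (double m); rewrite ?mna ?eqxx ?orbT.
have dim_nz b : b \in [:: 0; a; - a; m; - m] -> \dim (genspace (ad x) b) != 0%N.
  by rewrite dimG -lt0n -has_count has_pred1.
have [u Gu u0] : exists2 u, u \in genspace (ad x) m & u != 0.
  by apply/genspace_nz/dim_nz; rewrite !inE eqxx !orbT.
have [v Gv v0] : exists2 v, v \in genspace (ad x) (- m) & v != 0.
  by apply/genspace_nz/dim_nz; rewrite !inE eqxx !orbT.
(* Replacing [m] by - m exchanges [u] and [v], so the lemmas also cover the two ratios with a minus
   sign. *)
have dimG' b : \dim (genspace (ad x) b) = count_mem b [:: 0; a; - a; - m; - - m].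
  by rewrite dimG /= opprK; case: (m == b); case: (- m == b).
have [nm0 nma nmna] : [/\ - m != 0, - m != a & - m != - a].
  by rewrite oppr_eq0 eqr_opp eqr_oppLR m0 ma mna.
have Gu' : u \in genspace (ad x) (- - m) by rewrite opprK.
constructor 2.
case: (weight_ratio a0 m0 ma mna dimG Ge Gf ef0 Gu u0) => E.
- by have := weight_ratio_nz a0 m0 ma mna dimG Ge Gf ef0 Gu u0; rewrite E eqxx.
- have := weight_ratio_nz a0 nm0 nma nmna dimG' Ge Gf ef0 Gv v0.
  by rewrite E opprK eqxx.
- exact: weight_half_case a0 m0 ma mna dimG Ge Gf ef0 Gu u0 Gv v0 E.
- by apply: weight_half_case a0 nm0 nma nmna dimG' Ge Gf ef0 Gv v0 Gu' u0 _; rewrite mulrN.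
Qed.

(** * The solvable case *)

Lemma dim_add_line (K : fieldType) (V : vectType K) (U : {vspace V}) v :
  v \notin U -> \dim (U + <[v]>) = (\dim U).+1.
Proof.
move=> Uv; have v0 : v != 0 by apply: contraNneq Uv => ->; apply: mem0v.
rewrite dimv_disjoint_sum ?dim_vline ?v0 ?addn1 //.
apply/eqP; rewrite -subv0; apply/subvP => w /memv_capP[Uw /vlineP[k def_w]].
move: Uw; rewrite {w}def_w; have [->|k0] := eqVneq k 0; first by rewrite scale0r !mem0v.
by move/(memvZ k^-1); rewrite scalerA mulVf // scale1r (negPf Uv).
Qed.

Section Solvable.
Variables (K : numClosedFieldType) (g : finLieAlgType K).
Implicit Types (x y z v : g) (A I U V : {vspace g}).

Definition centralizer A : {vspace g} :=
  (\bigcap_(i < \dim A) lker (ad (vbasis A)`_i))%VS.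

Lemma centralizerP A v : reflect {in A, forall a, [lie a, v] = 0} (v \in centralizer A).
Proof.
apply: (iffP idP) => [Cv a Aa|Av].
  rewrite (coord_vbasis Aa) -adE linear_sum sum_lfunE big1 // => i _.
  have /subvP/(_ _ Cv) : (centralizer A <= lker (ad (vbasis A)`_i))%VS by apply: bigcapv_inf
      (subvv _).
  by rewrite memv_ker linearZ scale_lfunE => /eqP ->; rewrite scaler0.
rewrite memvE; apply/subv_bigcapP => i _; rewrite -memvE memv_ker adE Av //.
by rewrite vbasis_mem ?memt_nth.
Qed.

Lemma lie_ideal_centralizer A : lie_ideal A -> lie_ideal (centralizer A).
Proof.
move=> idA x v /centralizerP Cv; apply/centralizerP => a Aa.
by rewrite lie_der (Cv a) // lie0r addr0 Cv // lieC memvN idA.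
Qed.

Hypothesis solv : lie_solvable {:g}.

Lemma lie_ideal_step I V : lie_ideal I -> lie_ideal V -> (I <= V)%VS -> ~~ (V <= I)%VS ->
  exists2 v, v \in V /\ v \notin I & forall x, exists c, [lie x, v] - c *: v \in I.
Proof.
move=> idI idV IV VI.
have [|h u _ Iu|v Vv [lam lamP]] := lie_eigenvector solv _ _ IV VI.
- by move=> h u _; apply: idV.
- exact: idI.
by exists v => // x; exists (lam x); apply: lamP; rewrite memvf.
Qed.

Lemma lie_ideal_add I v : lie_ideal I -> (forall x, exists c, [lie x, v] - c *: v \in I) ->
  lie_ideal (I + <[v]>).
Proof.
move=> idI vP x _ /memv_addP[u Iu [_ /vlineP[k ->] ->]]; have [c xv] := vP x.
rewrite lieDr lieZr -[[lie x, v]](subrK (c *: v)) scalerDr addrA memv_add //.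
  by rewrite memvD ?memvZ ?idI.
by rewrite !memvZ ?memv_line.
Qed.

(** Serves to cut an abelian ideal of dimension above 2 down to dimension exactly 3. *)
Lemma lie_ideal_dim V n : lie_ideal V -> (n <= \dim V)%N ->
  exists U, [/\ lie_ideal U, (U <= V)%VS & \dim U = n].
Proof.
move=> idV; elim: n => [_|n IHn ltnV].
  exists 0%VS; split; rewrite ?sub0v ?dimv0 // => x y.
  by rewrite memv0 => /eqP->; rewrite lie0r mem0v.
have [U [idU UV dimU]] := IHn (ltnW ltnV).
have VU : ~~ (V <= U)%VS by apply: contraL ltnV => /dimvS; rewrite dimU -leqNgt.
have [v [Vv Uv] vP] := lie_ideal_step idU idV UV VU.
exists (U + <[v]>)%VS; split; first exact: lie_ideal_add.
  by rewrite subv_add UV.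
by rewrite dim_add_line ?dimU.
Qed.

(** If the centralizer of [A] exceeds [A], Lie's theorem enlarges [A] by a vector of the
    centralizer, and the larger ideal is still abelian. *)
Lemma self_centralizing_ideal : exists A,
  [/\ lie_ideal A, lie_abelian_on A & centralizer A = A].
Proof.
have sub_cent A : lie_abelian_on A -> (A <= centralizer A)%VS.
  by move=> abA; apply/subvP => a Aa; apply/centralizerP => b Ab; apply: abA.
suff: forall n A, (\dim {:g} - \dim A <= n)%N -> lie_ideal A -> lie_abelian_on A ->
    exists A, [/\ lie_ideal A, lie_abelian_on A & centralizer A = A].
  move=> /(_ _ 0%VS (leqnn _)); apply => [x y|x y].
    by rewrite memv0 => /eqP->; rewrite lie0r mem0v.
  by rewrite memv0 => /eqP->; rewrite lie0l.
elim=> [|n IHn] A dimA idA abA; have AC := sub_cent A abA.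
  exists A; split => //; apply/eqP; rewrite eqEsubv AC andbT.
  by rewrite {2}(_ : A = {:g}%VS) ?subvf //; apply/eqP; rewrite eqEdim subvf -subn_eq0 -leqn0.
have [CA|CA] := boolP (centralizer A <= A)%VS.
  by exists A; split => //; apply/eqP; rewrite eqEsubv CA.
have [v [/centralizerP Cv Av] vP] := lie_ideal_step idA (lie_ideal_centralizer idA) AC CA.
apply: (IHn (A + <[v]>)%VS); first by rewrite dim_add_line // subnS; lia.
  exact: lie_ideal_add.
move=> _ _ /memv_addP[a Aa [_ /vlineP[k ->] ->]] /memv_addP[b Ab [_ /vlineP[l ->] ->]].
rewrite lieDl !lieDr !lieZl !lieZr liexx abA // Cv // (lieC v) Cv // oppr0.
by rewrite !scaler0 !addr0.
Qed.

(* [A] is two-dimensional and [g / A] acts on it faithfully by triangular matrices, so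
   by dimension it is the whole triangular algebra. A lift [t] of the identity acts as
   the identity on [A], and [z - [t, z]] corrects any lift [z] to commute with [t]. *)
Theorem solvable_dim5 : \dim {:g} = 5%N ->
    ~ (exists I, [/\ lie_ideal I, lie_abelian_on I & \dim I = 3%N]) ->
  lie_isog g (upper_sl K 3).
Proof.
move=> dimg no_ideal; have [A [idA abA CA]] := self_centralizing_ideal.
have dimA_le2 : (\dim A <= 2)%N.
  rewrite leqNgt; apply/negP => /(lie_ideal_dim idA)[U [idU UA dimU]].
  by apply: no_ideal; exists U; split => // x y /(subvP UA) Ax /(subvP UA); apply: abA.
have zero_stable : lie_ideal (0 : {vspace g}).
  by move=> x y; rewrite memv0 => /eqP->; rewrite lie0r mem0v.
have A0 : A != 0%VS.
  apply/eqP => A0; move: CA; rewrite A0 => C0.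
  suff E : centralizer 0 = {:g}%VS by move: dimg; rewrite -E C0 dimv0.
  apply/eqP; rewrite eqEsubv subvf; apply/subvP => v _.
  by apply/centralizerP => a; rewrite memv0 => /eqP ->; rewrite lie0l.
have [a [Aa a0] aP] : exists2 a, a \in A /\ a \notin (0 : {vspace g})%VS &
    forall x, exists c, [lie x, a] - c *: a \in (0 : {vspace g})%VS.
  by apply: lie_ideal_step zero_stable idA _ _; rewrite ?sub0v ?subv0.
rewrite memv0 in a0.
have aP' x : exists c, [lie x, a] = c *: a.
  by have [c] := aP x; rewrite memv0 subr_eq0 => /eqP; exists c.
have sub_aA : (<[a]> <= A)%VS by rewrite -memvE.
have idline : lie_ideal <[a]>%VS.
  by move=> x _ /vlineP[k ->]; have [c ax] := aP' x; rewrite lieZr ax !memvZ ?memv_line.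
have A_ad y : {in A, forall c, [lie c, y] = 0} -> y \in A.
  by move=> /centralizerP; rewrite CA.
(* If [A] were the line of [a], the kernel and the image of [ad a] would both lie in [A], giving 5
   at most 2. *)
have dimA : \dim A = 2%N.
  apply/eqP; rewrite eqn_leq dimA_le2 ltnNge; apply/negP => dimA_le1.
  have eqA : A = <[a]>%VS.
    by apply/esym/eqP; rewrite eqEdim sub_aA dim_vline a0.
  have kerA : (lker (ad a) <= A)%VS.
    apply/subvP => y; rewrite memv_ker adE => /eqP ay; apply: A_ad => c.
    by rewrite eqA => /vlineP[k ->]; rewrite lieZl ay scaler0.
  have imA : (limg (ad a) <= A)%VS.
    by apply/subvP => _ /memv_imgP[y _ ->]; rewrite adE lieC memvN idA.
  have := limg_ker_dim (ad a) fullv; rewrite capfv dimg.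
  by move: (dimvS kerA) (dimvS imA) dimA_le1; lia.
have notA_a : ~~ (A <= <[a]>)%VS by apply/negP => /dimvS; rewrite dimA dim_vline a0.
have [b [Ab ab] bP] := lie_ideal_step idline idA sub_aA notA_a.
have {}bP x : exists k c, [lie x, b] = k *: a + c *: b.
  by have [c /vlineP[k xb]] := bP x; exists k, c; rewrite -xb subrK.
have indab k c : k *: a + c *: b = 0 -> k = 0 /\ c = 0.
  move=> E; have c0 : c = 0.
    apply: contraNeq ab => c0; move/eqP: E;
        rewrite addrC addr_eq0 => /eqP/(congr1 (fun w => c^-1 *: w)).
    by rewrite scalerA mulVf // scale1r => ->; rewrite memvZ ?memvN ?memvZ ?memv_line.
  by move/eqP: E; rewrite c0 scale0r addr0 scaler_eq0 (negPf a0) orbF => /eqP.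
have AE : A = (<[a]> + <[b]>)%VS.
  by apply/esym/eqP; rewrite eqEdim subv_add sub_aA -memvE Ab dim_add_line // dim_vline a0 dimA.
(* The action on the basis [a], [b] of [A]. Its kernel lies in [A], so its rank is at least 5 - 2 =
   3, and triangularity confines it to the span [W] of three vectors. *)
pose Phi : 'Hom(g, (g * g)%type) := linfun (fun x => ([lie x, a], [lie x, b])).
have Phi_lin : linear (fun x => ([lie x, a], [lie x, b]) : (g * g)%type).
  by move=> k x y; rewrite !lieDl !lieZl.
pose PhiM := GRing.isLinear.Build _ _ _ _ _ Phi_lin.
have PhiE x : Phi x = ([lie x, a], [lie x, b]).
  exact: (lfunE (HB.pack (fun x => ([lie x, a], [lie x,
      b]) : (g * g)%type) PhiM : {linear g -> (g * g)%type})).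
pose W : {vspace (g * g)%type} := <<[:: (a, 0%R); (0%R, b); (0%R, a)]>>%VS.
have imW : limg Phi = W.
  have imW : (limg Phi <= W)%VS.
    apply/subvP => _ /memv_imgP[x _ ->]; rewrite PhiE.
    have [c ->] := aP' x; have [k [d ->]] := bP x.
    rewrite (_ : (_, _) = c *: (a, 0) + (d *: (0, b) + k *: (0, a))).
      by rewrite !memvD ?memvZ // memv_span ?inE ?eqxx ?orbT.
    by apply: injective_projections; rewrite /= ?scaler0 ?addr0 ?add0r // addrC.
  apply/eqP; rewrite eqEdim imW /=; apply: leq_trans (dim_span _) _ => /=.
  have kerA : (lker Phi <= A)%VS.
    apply/subvP => y; rewrite memv_ker PhiE => /eqP[ya yb]; apply: A_ad => c.
    rewrite AE => /memv_addP[_ /vlineP[k ->] [_ /vlineP[l ->] ->]].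
    by rewrite lieC lieDr !lieZr ya yb !scaler0 addr0 oppr0.
  have := limg_ker_dim Phi fullv; rewrite capfv dimg.
  by move: (dimvS kerA); rewrite dimA; lia.
have lift c k d : exists x, [lie x, a] = c *: a /\ [lie x, b] = k *: a + d *: b.
  have : (c *: a, k *: a + d *: b) \in W.
    rewrite (_ : (_, _) = c *: (a, 0) + (d *: (0, b) + k *: (0, a))).
      by rewrite !memvD ?memvZ // memv_span ?inE ?eqxx ?orbT.
    by apply: injective_projections; rewrite /= ?scaler0 ?addr0 ?add0r // addrC.
  by rewrite -imW => /memv_imgP[x _]; rewrite PhiE => -[-> ->]; exists x.
have [t [ta tb]] := lift 1 0 1; rewrite scale0r add0r !scale1r in ta tb.
have tA y : y \in A -> [lie t, y] = y.
  rewrite AE => /memv_addP[_ /vlineP[k ->] [_ /vlineP[l ->] ->]].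
  by rewrite lieDr !lieZr ta tb.
have lift_t c k d : exists x,
    [/\ [lie x, a] = c *: a, [lie x, b] = k *: a + d *: b & [lie t, x] = 0].
  have [z [za zb]] := lift c k d.
  (* As [t] acts on [A] by a scalar, [[lie t, z]] acts as zero on [A], hence lies in its own
     centralizer [A]. *)
  have tzA : [lie t, z] \in A.
    apply: A_ad => y Ay; rewrite lieC lie_lieE (tA y Ay) tA ?subrr ?oppr0 //.
    exact: idA.
  exists (z - [lie t, z]); rewrite !lieDl !lieNl !(abA [lie t, z]) // !subr0.
  by rewrite za zb lieDr lieNr (tA _ tzA) subrr.
(* An element killing [A] lies in [A], where [ad t] is the identity. So relations between elements
   commuting with [t] need only be checked on [a] and [b]. *)
have vanish y : [lie t, y] = 0 -> [lie y, a] = 0 -> [lie y, b] = 0 -> y = 0.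
  move=> ty ya yb; rewrite -ty tA //; apply: A_ad => c.
  rewrite AE => /memv_addP[_ /vlineP[k ->] [_ /vlineP[l ->] ->]].
  by rewrite lieC lieDr !lieZr ya yb !scaler0 addr0 oppr0.
(* [p], [q], [n] lift the matrix units E00, E11, E01 of the triangular algebra in the basis [a],
   [b]. *)
have [p [pa pb tp]] := lift_t 1 0 0; have [q [qa qb tq]] := lift_t 0 0 1.
have [n [na nb tn]] := lift_t 0 1 0.
rewrite ?scale0r ?scale1r ?addr0 ?add0r in pa pb qa qb na nb.
have t_lie y z : [lie t, y] = 0 -> [lie t, z] = 0 -> [lie t, [lie y, z]] = 0.
  by move=> ty tz; rewrite lie_der ty tz lie0l lie0r addr0.
have pq : [lie p, q] = 0.
  by apply: vanish; rewrite ?t_lie // lie_lieE ?qa ?pa ?qb ?pb ?lie0r ?qa ?pb ?subrr.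
have pn : [lie p, n] = n.
  apply/eqP; rewrite -subr_eq0; apply/eqP; apply: vanish.
  - by rewrite lieDr lieNr t_lie // tn subr0.
  - by rewrite lieDl lieNl lie_lieE na pa lie0r na !subr0.
  - by rewrite lieDl lieNl lie_lieE nb pb lie0r pa subr0 subrr.
have qn : [lie q, n] = - n.
  apply/eqP; rewrite -subr_eq0 opprK; apply/eqP; apply: vanish.
  - by rewrite lieDr t_lie // tn addr0.
  - by rewrite lieDl lie_lieE na qa !lie0r subrr addr0.
  - by rewrite lieDl lie_lieE nb qb qa nb sub0r addNr.
have indep (x y z r s : K) : comb3 p q n x y z + comb2 a b r s = 0 ->
    [/\ x = 0, y = 0, z = 0, r = 0 & s = 0].
  move=> E.
  have x0 : x = 0.
    have := congr1 (lie^~ a) E; rewrite lie0l /comb3 /comb2 !lieDl !lieZl pa qa na liexx (abA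
        b a) //.
    by rewrite !scaler0 !addr0 => /eqP; rewrite scaler_eq0 (negPf a0) orbF => /eqP.
  have /indab[z0 y0] : z *: a + y *: b = 0.
    have := congr1 (lie^~ b) E; rewrite lie0l /comb3 /comb2 !lieDl !lieZl pb qb nb liexx (abA
        a b) //.
    by rewrite !scaler0 !addr0 add0r addrC.
  by move: E; rewrite x0 y0 z0 comb30 add0r => /indab[-> ->].
apply: (@lie_isog_upper_sl _ _ p q n a b) => //; rewrite ?pnatr_eq0 ?abA //.
move=> v; have : v \in <<[:: p; q; n; a; b]>>%VS.
  suff -> : <<[:: p; q; n; a; b]>>%VS = {:g}%VS by rewrite memvf.
  apply/eqP; rewrite eqEdim subvf dimg.
  suff : free [tuple p; q; n; a; b] by rewrite /free => /eqP ->.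
  apply/freeP => k; rewrite !big_ord_recl big_ord0 addr0 /= => E i.
  move: E; rewrite addrA [X in X = _]addrA => /indep[k0 k1 k2 k3 k4].
  case: (unliftP ord0 i) => [i1|] -> //; case: (unliftP ord0 i1) => [i2|] -> //.
  case: (unliftP ord0 i2) => [i3|] -> //; case: (unliftP ord0 i3) => [i4|] -> //.
  by rewrite ord1.
rewrite !span_cons span_nil addv0 => /memv_addP[_ /vlineP[x ->] [w1 Sw1 ->]].
case/memv_addP: Sw1 => _ /vlineP[y ->] [w2 Sw2 ->].
case/memv_addP: Sw2 => _ /vlineP[z ->] [w3 Sw3 ->].
case/memv_addP: Sw3 => _ /vlineP[r ->] [_ /vlineP[s ->] ->].
by exists x, y, z, r, s; rewrite /comb3 /comb2 !addrA.
Qed.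

End Solvable.

Local Open Scope complex_scope.

Theorem proposition3p2 (R : realType) (g : finLieAlgType R[i])
    (dim_g : \dim {:g} = 5%N)
    (no_ideal : ~ exists I : {vspace g},
       [/\ lie_ideal I, lie_abelian_on I & \dim I = 3%N]) :
  [\/ lie_isog g (sl R[i] 2 * abelian_lie 'cV[R[i]]_2)%type,
      lie_isog g (semidirect (sl_std R[i] 2)),
      exists r2 : finLieAlgType R[i],
        [/\ \dim {:r2} = 2%N, ~ lie_abelian r2 & lie_isog g (sl R[i] 2 * r2)%type]
    | lie_isog g (upper_sl R[i] 3)].
Proof.
have [solv|nsolv] := pselect (lie_solvable {:g}).
  by constructor 4; apply: solvable_dim5 solv dim_g no_ideal.
by case: (nonsolvable_dim5 dim_g nsolv); [constructor 1|constructor 2|constructor 3].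
Qed.
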